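(* Let $X$ be a Fréchet sequence algebra for the coordinatewise product which admits a continuous norm. Assume that $(e_n)_{n\ge0}$ is a Schauder basis of $X$. Let $B_w$ be a bounded weighted backward shift on $X$. The following assertions are equivalent. (i) $B_w$ supports a hypercyclic algebra which is dense in $X$ and not finitely generated. (ii) There exists a sequence of integers $(n_k)$ such that, for all $\gamma>0$ and all $l\in\mathbb N$, the sequence $\big((w_{l+1}\cdots w_{n_k+l})^{-\gamma}e_{n_k+l}\big)_k$ tends to zero in $X$.
   Context: $\mathbb N=\{1,2,\dots\}$, $\mathbb N_0=\mathbb N\cup\{0\}$, $\omega=\mathbb C^{\mathbb N_0}$, and $e_n\in\omega$ is the sequence with $1$ in position $n$ and $0$ elsewhere. A Fréchet sequence algebra is a subspace $X$ of $\omega$ which is a Fréchet space (complete metrizable) for the topology induced by a non-decreasing sequence of seminorms $(\|\cdot\|_q)_{q\ge1}$, such that convergence in $X$ implies coordinatewise convergence, endowed with a product satisfying $\|x\cdot y\|_q\le\|x\|_q\|y\|_q$ for all $x,y\in X$, $q\ge1$. The coordinatewise product is $(x_n)\cdot(y_n)=(x_ny_n)$. $X$ admits a continuous norm if there is a norm on $X$ which is continuous for its topology, i.e. bounded by $C\|\cdot\|_q$ for some $q\ge1$, $C>0$. For a sequence $w=(w_n)_{n\ge1}$ of nonzero complex numbers, $B_w(x_0,x_1,\dots)=(w_1x_1,w_2x_2,\dots)$; ''bounded on $X$'' means that $B_w$ is a continuous linear operator from $X$ to $X$. For $z\in\mathbb C\setminus\{0\}$, $z^{-\gamma}$ denotes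 any determination of the power (only its modulus matters for the convergence). Sequences $(n_k)$ consist of positive integers. $HC(T)$ is the set of $x\in X$ whose orbit $\{x,Tx,T^2x,\dots\}$ is dense in $X$. A hypercyclic algebra for $T$ is a subalgebra of $X$, different from $\{0\}$ and not required to be unital, contained in $HC(T)\cup\{0\}$; finitely generated means generated, as a (non-unital) algebra, by finitely many elements. *)

(* Defs.v *)
From HB Require Import structures.
From mathcomp Require Import all_boot all_order all_algebra.
From mathcomp Require Import complex.
From mathcomp Require Import all_classical all_reals all_analysis.
Set Implicit Arguments.
Unset Strict Implicit.
Unset Printing Implicit Defensive.
Import Order.TTheory GRing.Theory Num.Theory.
Import numFieldNormedType.Exports.
Local Open Scope classical_set_scope.
Local Open Scope ring_scope.
Local Open Scope complex_scope.

Section ComplexPower.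
Context {R : realType}.
Implicit Types z a : R[i].

Definition cexp z : R[i] :=
  (expR (complex.Re z))%:C * (cos (complex.Im z) +i* sin (complex.Im z)).

(* Complex powers are multivalued: the values of z ^ s, for z != 0, are the
   exp (s * L) where L runs through the logarithms of z. *)
Definition cpow_determination z (s : R) a : Prop :=
  exists2 L : R[i], cexp L = z & a = cexp (s%:C * L).

Lemma clog_exists z : z != 0 -> exists L, cexp L = z.
Proof.
case: z => x y z0; set r := Num.sqrt (x ^+ 2 + y ^+ 2).
have r20 : 0 < x ^+ 2 + y ^+ 2.
  rewrite lt_neqAle addr_ge0 ?sqr_ge0// andbT eq_sym.
  rewrite paddr_eq0 ?sqr_ge0// !sqrf_eq0; apply: contra z0.
  by move=> /andP[/eqP -> /eqP ->].
have r0 : 0 < r by rewrite sqrtr_gt0.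
have rE : r ^+ 2 = x ^+ 2 + y ^+ 2 by rewrite sqr_sqrtr// ltW.
have xr : `|x| <= r by rewrite -sqrtr_sqr ler_wsqrtr// lerDl sqr_ge0.
have hx : -1 <= x / r <= 1.
  by rewrite -ler_norml normrM normfV (gtr0_norm r0) ler_pdivrMr// mul1r.
have hs : r * sin (acos (x / r)) = `|y|.
  rewrite sin_acos// -[X in X * _](gtr0_norm r0) -sqrtr_sqr -sqrtrM ?sqr_ge0//.
  rewrite mulrBr mulr1 expr_div_n mulrCA divff ?mulr1; last first.
    by rewrite expf_neq0// gt_eqF.
  by rewrite rE addrC addKr sqrtr_sqr.
have hc : r * cos (acos (x / r)) = x.
  by rewrite acosK ?in_itv//= mulrC divfK// gt_eqF.
pose t := if 0 <= y then acos (x / r) else - acos (x / r).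
exists (ln r +i* t); rewrite /cexp /= lnK ?posrE//.
apply/eqP; rewrite eq_complex /= !mul0r subr0 addr0; apply/andP; split.
  by rewrite /t; case: ifP => _; rewrite ?cosN hc.
rewrite /t; case: ifPn => [y0|]; first by rewrite hs ger0_norm.
by rewrite -ltNge => y0; rewrite sinN mulrN hs ltr0_norm// opprK.
Qed.

Lemma cpow_determination_exists z s : z != 0 ->
  exists a, cpow_determination z s a.
Proof. by move=> /clog_exists[L Lz]; exists (cexp (s%:C * L)); exists L. Qed.

End ComplexPower.

Section Seminorm.
Context {R : realType} {V : lmodType R[i]}.

Definition is_seminorm (p : V -> R) : Prop :=
  (forall x y, p (x + y) <= p x + p y) /\
  (forall (c : R[i]) x, p (c *: x) = ComplexField.Normc.normc c * p x).

Definition is_norm (p : V -> R) : Prop :=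
  is_seminorm p /\ (forall x, p x = 0 -> x = 0).

Lemma seminorm0 p : is_seminorm p -> p 0 = 0.
Proof.
by move=> [_ pZ]; rewrite -(scale0r 0) pZ ComplexField.Normc.normc0 mul0r.
Qed.

Lemma seminormN p x : is_seminorm p -> p (- x) = p x.
Proof.
move=> [_ pZ]; rewrite -scaleN1r pZ normcN.
by rewrite ComplexField.Normc.normc1 mul1r.
Qed.

End Seminorm.

Record seqSpace (R : realType) := SeqSpace {
  seqSpace_pred :> {pred (nat -> R[i])} ;
  seqSpace_closed : submod_closed seqSpace_pred }.

HB.instance Definition _ (R : realType) (S : seqSpace R) :=
  GRing.isSubmodClosed.Build R[i] (nat -> R[i]) (seqSpace_pred S)
    (seqSpace_closed S).

Definition seqSpace_elt (R : realType) (S : seqSpace R) :=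
  {x : nat -> R[i] | x \in seqSpace_pred S}.
HB.instance Definition _ (R : realType) (S : seqSpace R) :=
  SubChoice.on (seqSpace_elt S).
HB.instance Definition _ (R : realType) (S : seqSpace R) :=
  [SubChoice_isSubLmodule of seqSpace_elt S by <:].

(* A subspace of C^N stable under the coordinatewise product (which is the
   product of the ring of functions nat -> R[i]), with a non-decreasing sequence
   of submultiplicative seminorms; the index q : nat stands for q + 1. *)
Record seqAlgebra (R : realType) := SeqAlgebra {
  seqAlgebra_space :> seqSpace R ;
  seqAlgebra_mulr : {in seqAlgebra_space &, forall x y,
    x * y \in seqSpace_pred seqAlgebra_space} ;
  seqnorm : nat -> seqSpace_elt seqAlgebra_space -> R ;
  seqnorm_seminorm : forall q, is_seminorm (seqnorm q) ;
  seqnorm_ndecr : forall q x, seqnorm q x <= seqnorm q.+1 x ;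
  seqnorm_submult : forall q (x y xy : seqSpace_elt seqAlgebra_space),
    \val xy = \val x * \val y -> seqnorm q xy <= seqnorm q x * seqnorm q y }.

Definition seqelt (R : realType) (X : seqAlgebra R) :=
  seqSpace_elt (seqAlgebra_space X).
Coercion seqelt : seqAlgebra >-> Sortclass.
HB.instance Definition _ (R : realType) (X : seqAlgebra R) :=
  GRing.SubLmodule.on (seqelt X).
HB.instance Definition _ (R : realType) (X : seqAlgebra R) :=
  isPointed.Build (seqelt X) 0.

Section Uniformity.
Context {R : realType} (X : seqAlgebra R).
Local Open Scope relation_scope.

Definition seqent : set_system (X * X) :=
  [set E | exists q (eps : R), 0 < eps /\
    forall x y : X, seqnorm q (x - y) < eps -> E (x, y)].

Lemma seqnorm_homo q r (x : X) : (q <= r)%N -> seqnorm q x <= seqnorm r x.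
Proof.
elim: r => [|r IH]; first by rewrite leqn0 => /eqP ->.
rewrite leq_eqVlt => /orP[/eqP -> //|]; rewrite ltnS => /IH /le_trans; apply.
exact: seqnorm_ndecr.
Qed.

Let seqent_filter : Filter seqent.
Proof.
split; first by exists 0%N, 1; split.
- move=> P Q [q [e [e0 hP]]] [r [d [d0 hQ]]].
  exists (maxn q r), (Num.min e d); split; first by rewrite lt_min e0 d0.
  move=> x y; rewrite lt_min => /andP[he hd]; split.
    by apply: hP; apply: le_lt_trans he; rewrite seqnorm_homo// leq_maxl.
  by apply: hQ; apply: le_lt_trans hd; rewrite seqnorm_homo// leq_maxr.
- move=> P Q PQ [q [e [e0 hP]]]; exists q, e; split => // x y xy.
  by apply: PQ; exact: hP.
Qed.

Let seqent_refl E : seqent E -> diagonal `<=` E.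
Proof.
move=> [q [e [e0 hE]]] [x y] /= xy; apply: hE.
by rewrite (xy : x = y) subrr seminorm0//; exact: seqnorm_seminorm.
Qed.

Let seqent_inv E : seqent E -> seqent E^-1.
Proof.
move=> [q [e [e0 hE]]]; exists q, e; split => // x y xy; apply: hE.
by rewrite -opprB seminormN//; exact: seqnorm_seminorm.
Qed.

Let seqent_split E : seqent E -> exists2 F, seqent F & F \; F `<=` E.
Proof.
move=> [q [e [e0 hE]]].
exists [set xy | seqnorm q (xy.1 - xy.2) < e / 2].
  by exists q, (e / 2); split => //; rewrite divr_gt0.
move=> [x z] [y /= xy yz]; apply: hE; rewrite (splitr e).
have -> : x - z = (x - y) + (y - z) by rewrite subrKA.
by apply: le_lt_trans (ltrD xy yz); case: (seqnorm_seminorm X q) => + _; apply.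
Qed.

HB.instance Definition _ := @isUniform.Build (seqelt X) seqent
  seqent_filter seqent_refl seqent_inv seqent_split.

Lemma nbhs_seqnorm (x : X) (A : set X) : nbhs x A <->
  exists q (eps : R), 0 < eps /\
    forall y : X, seqnorm q (x - y) < eps -> A y.
Proof.
rewrite -nbhs_entourageE; split.
- move=> [E [q [e [e0 hE]]] EA]; exists q, e; split => // y xy.
  by apply: EA; apply/mem_set; exact: hE.
- move=> [q [e [e0 hA]]]; exists [set xy | seqnorm q (xy.1 - xy.2) < e].
    by exists q, e; split.
  by move=> y /set_mem /= /hA.
Qed.

End Uniformity.

Section FrechetSequenceAlgebra.
Context {R : realType} (X : seqAlgebra R).

(* Being defined by countably many seminorms, the topology of X is metrizable
   as soon as it is Hausdorff. *)
Record frechet_sequence_algebra : Prop := FrechetSequenceAlgebra {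
  seq_hausdorff : hausdorff_space X ;
  seq_complete : forall F : set_system X, ProperFilter F -> cauchy F -> cvg F ;
  seq_coordinates : forall (u : nat -> X) (x : X), u @ \oo --> x ->
    forall n, (\val (u k) n : R[i]^o) @[k --> \oo] --> (\val x n : R[i]^o) }.

Definition admits_continuous_norm : Prop :=
  exists2 N : X -> R, is_norm N & continuous N.

Definition schauder_basis (b : nat -> X) : Prop :=
  forall x : X, exists! a : nat -> R[i],
    series (fun k => a k *: b k) @ \oo --> x.

Definition seqmul (x y : X) : X :=
  exist _ (\val x * \val y) (seqAlgebra_mulr (valP x) (valP y)).

Definition subalgebra (A : set X) : Prop :=
  [/\ A 0, forall x y, A x -> A y -> A (x + y),
      forall (c : R[i]) x, A x -> A (c *: x) &
      forall x y, A x -> A y -> A (seqmul x y)].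

Definition finitely_generated (A : set X) : Prop :=
  exists2 G : set X, finite_set G & A = smallest subalgebra G.

End FrechetSequenceAlgebra.

Definition hypercyclic_vectors (V : topologicalType) (T : V -> V) : set V :=
  [set x | dense (range (fun n => iter n T x))].

Definition hypercyclic_algebra (R : realType) (X : seqAlgebra R) (T : X -> X)
    (A : set X) : Prop :=
  [/\ subalgebra A, A <> [set 0] & A `<=` hypercyclic_vectors T `|` [set 0]].

(* The weights are w 1, w 2, ...; the value w 0 is never used. *)
Definition backward_shift (R : realType) (w x : nat -> R[i]) : nat -> R[i] :=
  fun n => w n.+1 * x n.+1.

Definition unit_seq (R : realType) (n : nat) : nat -> R[i] :=
  fun m => (m == n)%:R.

(* Main.v *)
(* Since [e_n * e_n = e_n] and a continuous norm exists, [|e_n|_q >= 1] for all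
   large [q], and then every coordinate is bounded by [|.|_q].

   Necessity: if all the powers of [x] are hypercyclic, some [B^n (x^m)] has its
   first coordinates of modulus at least [1], that is,
   [|w_{l+1} .. w_{n+l}|^(-1/m) <= |x_{n+l}|], and [x_n e_n] tends to [0]
   because [e] is a Schauder basis. A diagonal argument gives the sequence.

   Sufficiency: the generators are indexed by the prime numbers, so that
   monomials are indexed by the integers [a >= 2] via unique factorization, and
   the algebra is the linear span of vectors [f_a] with [f_a f_b = f_(ab)], each
   of whose coordinates is a completely multiplicative function of [a]. Near the
   position [N] of a stage of base [b] and target [v], the [N + l]-th coordinate
   of [f_a] is [(v_l / (w_{l+1} .. w_{N+l})) ^ (ln a / ln b)]: the shift [B^N]
   sends [f_b] close to [v] and [f_a] close to [0] when [a > b]. With [b] the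
   smallest index of a nonzero combination, all such combinations are
   hypercyclic. In particular the [f_a] are linearly independent, and a finite
   set only generates combinations of [f_a] with [a] smooth, so that the algebra
   is not finitely generated. *)
Require Import Defs.
From mathcomp Require Import all_boot all_order all_algebra.
From mathcomp Require Import complex.
From mathcomp Require Import all_classical all_reals all_analysis.
From mathcomp Require Import ring lra.
Import Order.TTheory GRing.Theory Num.Theory.
Import numFieldNormedType.Exports.
Local Open Scope classical_set_scope.
Local Open Scope ring_scope.
Local Open Scope complex_scope.
Import ComplexField.Normc.
Set Implicit Arguments.
Unset Strict Implicit.
Unset Printing Implicit Defensive.

(** * Complex powers as completely multiplicative functions *)

Section ComplexNorm.
Context {R : realType}.
Implicit Types z : R[i].

Lemma normc_ge0 z : 0 <= normc z.
Proof. by case: z => x y; rewrite sqrtr_ge0. Qed.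

Lemma normcX z n : normc (z ^+ n) = normc z ^+ n.
Proof.
by elim: n => [|n IH]; rewrite ?expr0 ?normc1// !exprS normcM IH.
Qed.

Lemma normc_gt0 z : (0 < normc z) = (z != 0).
Proof.
rewrite lt_neqAle normc_ge0 andbT eq_sym; apply/idP/idP; apply: contraNN.
  by move=> /eqP->; rewrite normc0.
by move=> /eqP/eq0_normc ->.
Qed.

Lemma prod_nat_neq0 (w : nat -> R[i]) m n :
  (forall i, (m <= i)%N -> w i != 0) -> \prod_(m <= j < n) w j != 0.
Proof.
move=> w0; rewrite big_nat; apply: (big_ind (fun x => x != 0)).
- exact: oner_neq0.
- by move=> x y; exact: mulf_neq0.
- by move=> i /andP[mi _]; exact: w0.
Qed.

Lemma le_normc_sum (I : Type) (s : seq I) (P : pred I) (F : I -> R[i]) :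
  normc (\sum_(i <- s | P i) F i) <= \sum_(i <- s | P i) normc (F i).
Proof.
elim/big_ind2: _ => [|x a y c hx hy|//]; first by rewrite normc0.
by rewrite (le_trans (le_normcD _ _)) ?lerD.
Qed.

Lemma normc_real (x : R) : normc x%:C = `|x|.
Proof. by rewrite /= expr0n addr0 sqrtr_sqr. Qed.

Lemma normc_cexp z : normc (cexp z) = expR (complex.Re z).
Proof.
by rewrite normcM normc_real /= cos2Dsin2 sqrtr1 mulr1 ger0_norm// expR_ge0.
Qed.

Lemma cexpD z z' : cexp (z + z') = cexp z * cexp z'.
Proof.
case: z z' => [x y] [x' y']; apply/eqP; rewrite eq_complex /cexp /=.
by rewrite !expRD cosD sinD !mul0r !subr0 !addr0; apply/andP; split;
  apply/eqP; ring.
Qed.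

Lemma cexp0 : cexp 0 = 1 :> R[i].
Proof. by rewrite /cexp /= expR0 cos0 sin0 mul1r. Qed.

Lemma Re_scale (s : R) z : complex.Re (s%:C * z) = complex.Re z * s.
Proof. by case: z => x y; rewrite /= mul0r subr0 mulrC. Qed.

Lemma normc_cpow z s a : cpow_determination z s a -> normc a = normc z `^ s.
Proof. by move=> [L <- ->]; rewrite !normc_cexp Re_scale expRM. Qed.

End ComplexNorm.

(** * Multiplicative functions with a prescribed value at one base *)

Section Character.
Context {R : realType}.
Implicit Types (z : R[i]) (a b : nat).

(* The completely multiplicative function of [a] whose value at [b] is [z]:
   [z ^ (ln a / ln b)] for a fixed determination of the logarithm of [z]. *)
Definition natchar z b a : R[i] :=
  if z == 0 then (a == 1%N)%:R
  else cexp ((ln a%:R / ln b%:R)%:C * xget 0 [set L | cexp L = z]).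

Let clogK z : z != 0 -> cexp (xget 0 [set L | cexp L = z]) = z.
Proof.
by move=> /clog_exists[L Lz]; exact: (@xgetI _ 0 [set L | cexp L = z] L Lz).
Qed.

Lemma natchar1 z b : natchar z b 1 = 1.
Proof.
by rewrite /natchar; case: ifP => // _; rewrite ln1 mul0r mul0r cexp0.
Qed.

Lemma natcharM z b a a' : (0 < a)%N -> (0 < a')%N ->
  natchar z b (a * a') = natchar z b a * natchar z b a'.
Proof.
move=> a0 a'0; rewrite /natchar; case: ifP => _.
  by rewrite muln_eq1 -natrM mulnb.
rewrite -cexpD -mulrDl -rmorphD/= -mulrDl natrM lnM ?posrE ?ltr0n//.
Qed.

Lemma natchar_base z b : (1 < b)%N -> natchar z b b = z.
Proof.
move=> b1; rewrite /natchar; case: eqVneq => [->|z0].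
  by rewrite gtn_eqF.
by rewrite divff ?mul1r ?clogK// gt_eqF// ln_gt0// ltr1n.
Qed.

Lemma normc_natchar z b a : (1 < b)%N -> (0 < a)%N ->
  normc (natchar z b a) = normc z `^ (ln a%:R / ln b%:R).
Proof.
move=> b1 a0; rewrite /natchar; case: eqVneq => [->|z0]; last first.
  by rewrite normc_cexp Re_scale expRM -normc_cexp clogK.
rewrite normc0; case: eqVneq => [->|a1].
  by rewrite ln1 mul0r powRr0 normc1.
rewrite powR0 ?normc0// mulf_neq0//; last first.
  by rewrite invr_neq0// gt_eqF// ln_gt0// ltr1n.
by rewrite gt_eqF// ln_gt0// ltr1n ltn_neqAle eq_sym a1.
Qed.

(** A power of a modulus at most 1 decreases with its exponent [ln a / ln b]. This lets the index
    [b.+1] control all indices above [b]. *)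
Lemma normc_natchar_anti z b a a' : (1 < b)%N -> (0 < a)%N -> (a <= a')%N ->
  normc z <= 1 -> normc (natchar z b a') <= normc (natchar z b a).
Proof.
move=> b1 a0 aa' z1; have a'0 := leq_trans a0 aa'.
have [->|z0] := eqVneq z 0.
  rewrite /natchar eqxx; case: eqVneq => [a'1|_]; last by rewrite normc0 normc_ge0.
  by have -> : a = 1%N by apply/eqP; rewrite eqn_leq a0 -a'1 aa'.
rewrite !normc_natchar//; apply: ger_powR; first by rewrite normc_gt0 z0.
rewrite ler_pM2r ?invr_gt0 ?ln_gt0 ?ltr1n//.
by rewrite ler_ln ?posrE ?ltr0n// ler_nat.
Qed.

(** With [s] the modulus at 2, the modulus at [a] is [s] to the power [log_2 a], that is, [s] times
    [s] to the power [log_2 a - 1]; since [s <= 1/2], the latter is at most [2 / a]. The bound does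
    not depend on [b]. *)
Lemma normc_natchar_decay z b a : (1 < b)%N -> (1 < a)%N ->
  normc (natchar z b 2) <= 2^-1 ->
  normc (natchar z b a) <= 2 / a%:R * normc (natchar z b 2).
Proof.
move=> b1 a1 h; have a0 := ltnW a1.
have ln2_gt0 : 0 < ln 2%:R :> R by rewrite ln_gt0// ltr1n.
have [z0|z0] := eqVneq z 0.
  by rewrite z0 /natchar eqxx (gtn_eqF a1) !normc0 mulr0.
have s0 : normc (natchar z b 2) != 0.
  by rewrite normc_natchar// powR_eq0 gt_eqF// normc_gt0.
set s := normc (natchar z b 2) in h s0 *.
have -> : normc (natchar z b a) = s `^ (ln a%:R / ln 2%:R).
  rewrite /s !normc_natchar// -powRrM; congr powR; rewrite [RHS]mulrC mulrA divfK//.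
  by rewrite gt_eqF.
have sE : s `^ (ln a%:R / ln 2%:R) = s `^ (ln a%:R / ln 2%:R - 1) * s.
  by rewrite [RHS]mulrC mulr_powRB1 ?normc_ge0// divr_gt0// ln_gt0// ltr1n.
rewrite sE ler_wpM2r ?normc_ge0//.
have ht : 0 <= ln a%:R / ln 2%:R - 1 :> R.
  rewrite subr_ge0 ler_pdivlMr// mul1r ler_ln ?posrE ?ltr0n// ler_nat//.
apply: le_trans (ge0_ler_powR ht _ _ h) _; rewrite ?nnegrE ?normc_ge0 ?invr_ge0//.
rewrite /powR gt_eqF ?invr_gt0// lnV ?posrE//.
have -> : (ln a%:R / ln 2%:R - 1) * - ln 2 = ln (2 / a%:R) :> R.
  rewrite ln_div ?posrE ?ltr0n// mulrN mulrBl mul1r divfK ?gt_eqF//.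
  by rewrite opprB.
by rewrite lnK// posrE divr_gt0// ltr0n.
Qed.
Lemma normc_natchar_le1 z b : (1 < b)%N -> normc (natchar z b 2) <= 1 ->
  normc z <= 1.
Proof.
move=> b1; rewrite normc_natchar// => h; rewrite leNgt; apply/negP => z1.
have : 1 `^ (ln 2%:R / ln b%:R) < normc z `^ (ln 2%:R / ln b%:R).
  by apply: gt0_ltr_powR; rewrite ?nnegrE ?normc_ge0 ?divr_gt0 ?ln_gt0 ?ltr1n.
by rewrite powR1 ltNge h.
Qed.

End Character.

(** * Seminorms and the unit vectors *)

Section SeqnormTheory.
Context {R : realType} {X : seqAlgebra R}.
Implicit Types (x y : X) (q : nat).

Lemma seqnormD q x y : seqnorm q (x + y) <= seqnorm q x + seqnorm q y.
Proof. by case: (seqnorm_seminorm X q). Qed.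

Lemma seqnormZ q (c : R[i]) x : seqnorm q (c *: x) = normc c * seqnorm q x.
Proof. by case: (seqnorm_seminorm X q). Qed.

Lemma seqnorm0 q : seqnorm q (0 : X) = 0.
Proof. exact: seminorm0 (seqnorm_seminorm X q). Qed.

Lemma seqnormN q x : seqnorm q (- x) = seqnorm q x.
Proof. exact: seminormN (seqnorm_seminorm X q). Qed.

Lemma seqnormB q x y : seqnorm q (x - y) = seqnorm q (y - x).
Proof. by rewrite -opprB seqnormN. Qed.

Lemma seqnorm_ge0 q x : 0 <= seqnorm q x.
Proof.
have := seqnormD q x (- x); rewrite subrr seqnorm0 seqnormN => h.
by rewrite -(pmulrn_lge0 _ (ltn0Sn 1)) mulr2n.
Qed.

Lemma seqnorm_sum q (I : Type) (s : seq I) (P : pred I) (F : I -> X) :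
  seqnorm q (\sum_(i <- s | P i) F i) <= \sum_(i <- s | P i) seqnorm q (F i).
Proof.
elim/big_ind2: _ => [|x a y b hx hy|//]; first by rewrite seqnorm0.
by rewrite (le_trans (seqnormD _ _ _))// lerD.
Qed.

Lemma cvg_seqnormP (u : nat -> X) x : u @ \oo --> x <->
  forall q (eps : R), 0 < eps ->
    \forall k \near \oo, seqnorm q (u k - x) < eps.
Proof.
split=> [ux q eps eps0|h A /nbhs_seqnorm[q [eps [eps0 hA]]]].
  have /ux : nbhs x [set y | seqnorm q (x - y) < eps].
    by apply/(nbhs_seqnorm (X := X)); exists q, eps.
  move=> h; have {}h : \forall k \near \oo, seqnorm q (x - u k) < eps := h.
  by near do rewrite seqnormB.
have {}h : \forall k \near \oo, seqnorm q (u k - x) < eps by exact: h.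
suff : \forall k \near \oo, A (u k) by [].
by near=> k; apply: hA; rewrite seqnormB; near: k.
Unshelve. all: by end_near. Qed.

Lemma continuous_seqnorm (f : X -> X) : continuous f -> f 0 = 0 ->
  forall q (eps : R), 0 < eps -> exists q' (del : R), 0 < del /\
    forall x, seqnorm q' x < del -> seqnorm q (f x) < eps.
Proof.
move=> cf f0 q eps eps0.
have /(cf 0) : nbhs (f 0) [set y | seqnorm q (f 0 - y) < eps].
  by apply/(nbhs_seqnorm (X := X)); exists q, eps.
move=> /nbhs_seqnorm[q' [del [del0 h]]]; exists q', del; split => // x hx.
by have := h x; rewrite /= f0 !sub0r !seqnormN; apply.
Qed.

Lemma open_seqball q x (eps : R) : open [set y : X | seqnorm q (y - x) < eps].
Proof.
rewrite openE => y yx; apply/nbhs_seqnorm.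
exists q, (eps - seqnorm q (y - x)); split; first by rewrite subr_gt0.
move=> y' hy /=; rewrite -(subrK y y') -addrA.
by apply: le_lt_trans (seqnormD _ _ _) _; rewrite -ltrBrDr seqnormB.
Qed.

Lemma val_sum (I : Type) (s : seq I) (P : pred I) (F : I -> X) n :
  \val (\sum_(i <- s | P i) F i) n = \sum_(i <- s | P i) \val (F i) n.
Proof. by rewrite raddf_sum fct_sumE. Qed.

Lemma valZ_coord (c : R[i]) x n : \val (c *: x) n = c * \val x n.
Proof. by rewrite linearZ. Qed.

Lemma valB_coord x y n : \val (x - y) n = \val x n - \val y n.
Proof. by rewrite raddfB. Qed.

End SeqnormTheory.

(** * Idempotence of the unit vectors and lower bounds on their seminorms *)

Section UnitVectors.
Context {R : realType} {X : seqAlgebra R} {e : nat -> X}.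
Hypothesis eE : forall n, \val (e n) = unit_seq R n.
Implicit Types (x y : X) (q : nat).

Lemma val_unit_sum K (c : nat -> R[i]) n :
  \val (\sum_(i < K) c i *: e i) n = if (n < K)%N then c n else 0.
Proof.
rewrite val_sum; under eq_bigr do rewrite valZ_coord eE /unit_seq.
case: ltnP => [nK|Kn].
  rewrite (bigD1 (Ordinal nK))//= eqxx mulr1 big1 ?addr0// => i ni.
  rewrite [n == i]eq_sym [(i : nat) == n](_ : _ = false) ?mulr0//.
  by apply: contraNF ni => /eqP ni; apply/eqP/val_inj.
rewrite big1// => i _; rewrite gtn_eqF ?mulr0//; exact: leq_trans (ltn_ord i) _.
Qed.

(** Since [e n] is idempotent, its seminorm [p] satisfies [p <= p ^ 2], hence [p >= 1] unless
    [p = 0]. The continuous norm, being controlled by some seminorm of index [q0], excludes [p = 0]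
    from [q0] on. *)
Lemma seqnorm_unit_ge1 : admits_continuous_norm X ->
  exists q0, forall q n, (q0 <= q)%N -> 1 <= seqnorm q (e n).
Proof.
move=> [N [sN N0] cN]; have [ND NZ] := sN.
have NO : N 0 = 0 by exact: seminorm0.
have Nge0 x : 0 <= N x.
  have := ND x (- x); rewrite subrr NO seminormN// => h.
  by rewrite -(pmulrn_lge0 _ (ltn0Sn 1)) mulr2n.
have /(cN 0) : nbhs (N 0) [set r | `|r| < 1 :> R].
  rewrite NO; exists 1 => //= r /=; by rewrite sub0r normrN.
move=> /nbhs_seqnorm[q0 [eps [eps0 h]]]; exists q0 => q n q0q.
have en0 : e n != 0.
  apply/eqP => en0; have := congr1 (fun x => \val x n) en0.
  rewrite eE /unit_seq eqxx /= => /eqP; by rewrite oner_eq0.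
have pn0 : seqnorm q (e n) != 0.
  apply/eqP => p0; have p00 : seqnorm q0 (e n) = 0.
    by apply/eqP; rewrite eq_le seqnorm_ge0 -p0 seqnorm_homo.
  have Nn : N (e n) != 0 by apply: contraNneq en0 => /N0 ->.
  (* Otherwise the multiple of [e n] of norm 1 would lie in every ball of [seqnorm q0], where the
     norm is less than 1. *)
  have /h /= : seqnorm q0 (0 - (N (e n))^-1%:C *: e n) < eps.
    by rewrite sub0r seqnormN seqnormZ p00 mulr0.
  by rewrite NZ normc_real normrM normr_id -normrM mulVf// normr1 ltxx.
have pp : 0 < seqnorm q (e n) by rewrite lt_neqAle eq_sym pn0 seqnorm_ge0.
have := @seqnorm_submult _ X q (e n) (e n) (e n); rewrite -{1}[seqnorm q _]mul1r ler_pM2r//.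
by apply; apply/funext => m; rewrite eE /unit_seq /GRing.mul/=; case: (m == n);
  rewrite ?mulr1 ?mulr0.
Qed.

(** Apply submultiplicativity to the product of [x] and [e n], which is the multiple of [e n] by the
    coordinate of [x]. *)
Lemma normc_coord_le q x n : 1 <= seqnorm q (e n) ->
  normc (\val x n) <= seqnorm q x.
Proof.
move=> p1; have pp : 0 < seqnorm q (e n) by exact: lt_le_trans p1.
rewrite -(ler_pM2r pp) -seqnormZ.
apply: seqnorm_submult; apply/funext => m.
change (\val (\val x n *: e n) m = \val x m * \val (e n) m).
rewrite valZ_coord eE /unit_seq.
by case: eqVneq => [->|_]; rewrite ?mulr0.
Qed.

End UnitVectors.

(** * Coordinates and the weighted shift *)

Section Basis.
Context {R : realType} {X : seqAlgebra R} {e : nat -> X}.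
Hypothesis eE : forall n, \val (e n) = unit_seq R n.
Hypothesis basis_e : schauder_basis e.
Context {q0 : nat}.
Hypothesis unit_ge1 : forall q n, (q0 <= q)%N -> 1 <= seqnorm q (e n).
Implicit Types (x y : X) (q : nat).

Lemma normc_eq0_lt (z : R[i]) : (forall eps : R, 0 < eps -> normc z < eps) ->
  z = 0.
Proof.
move=> h; apply/eqP; rewrite -[_ == 0]negbK -normc_gt0; apply/negP => z0.
by have := h _ z0; rewrite ltxx.
Qed.

Lemma coord_cvg (u : nat -> X) x n (z : R[i]) : u @ \oo --> x ->
  (\forall k \near \oo, \val (u k) n = z) -> \val x n = z.
Proof.
move=> ux un; apply/eqP; rewrite -subr_eq0; apply/eqP.
apply: normc_eq0_lt => /= eps eps0.
have [k []] : exists k : nat, seqnorm q0 (u k - x) < eps /\ \val (u k) n = z.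
  apply: filter_ex (filterI _ un); exact: (cvg_seqnormP u x).1.
move=> ukx ukn; apply: le_lt_trans ukx; rewrite -ukn -valB_coord seqnormB.
by apply: (normc_coord_le eE); rewrite unit_ge1.
Qed.

(** The coefficients given by the basis property are the coordinates: the [n]-th coordinate of the
    partial sums is constant once they pass [n], and coordinates are continuous. *)
Lemma unit_expansion x q (eps : R) : 0 < eps -> \forall k \near \oo,
  seqnorm q (\sum_(i < k) \val x i *: e i - x) < eps.
Proof.
move=> eps0; have [a [ax _]] := basis_e x.
have aE n : \val x n = a n.
  apply: (coord_cvg ax); near=> k; rewrite seriesEord (val_unit_sum eE) ifT//.
  by near: k; exact: nbhs_infty_gt.
have := (cvg_seqnormP _ _).1 ax q eps eps0; apply: filterS => k.
by rewrite seriesEord; under [in X in _ -> X]eq_bigr do rewrite aE.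
Unshelve. all: by end_near. Qed.

Lemma seqnorm_le q x (S : R) :
  (forall K, \sum_(l < K) normc (\val x l) * seqnorm q (e l) <= S) ->
  seqnorm q x <= S.
Proof.
move=> h; apply/ler_addgt0Pr => eps eps0.
have [k hk] := filter_ex (unit_expansion x q eps0).
set s := \sum_(i < k) _ in hk.
rewrite -[x](subrK s) addrC (le_trans (seqnormD _ _ _))//.
apply: lerD; last by rewrite seqnormB ltW.
apply: le_trans (h k); apply: le_trans (seqnorm_sum _ _ _ _) _.
by apply: ler_sum => i _; rewrite seqnormZ.
Qed.

Lemma seq_exists (a : nat -> R[i]) : frechet_sequence_algebra X ->
  (forall q, exists S : R,
    forall K, \sum_(l < K) normc (a l) * seqnorm q (e l) <= S) ->
  exists x : X, \val x = a.
Proof.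
move=> fX h; pose s := series (fun i => a i *: e i).
pose u q := series (fun i => normc (a i) * seqnorm q (e i)).
have su q m n : seqnorm q (s m - s n) <= `|u q m - u q n|.
  wlog nm : m n / (n <= m)%N.
    by move=> H; case: (leqP n m) => [/H//|/ltnW/H]; rewrite seqnormB distrC.
  rewrite !sub_series_geq// (le_trans (seqnorm_sum _ _ _ _))//.
  apply: le_trans (ler_norm _); apply: ler_sum => i _; by rewrite seqnormZ.
have cu q : cvgn (u q).
  apply: nondecreasing_is_cvgn.
    apply/nondecreasing_seqP => n; rewrite /u !seriesEord /= big_ord_recr/= lerDl.
    by rewrite mulr_ge0 ?normc_ge0 ?seqnorm_ge0.
  by have [S hS] := h q; exists S => _ [n _ <-]; rewrite /u seriesEord; exact: hS.
have sc : cauchy (s @ \oo).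
  move=> E [q [eps [eps0 hE]]].
  have e20 : 0 < eps / 2 by rewrite divr_gt0.
  have ul := (@cvgrPdist_lt _ _ _ _ _ (u q) _).1 (cu q) _ e20.
  have [N _ hN] := ul.
  exists (s @` [set n | (N <= n)%N], s @` [set n | (N <= n)%N]) => /=.
    by split; exists N => // n Nn; exists n.
  move=> [_ _] [/= [m Nm <-] [n Nn <-]]; apply: hE; apply: le_lt_trans (su _ _ _) _.
  have -> : u q m - u q n = (limn (u q) - u q n) - (limn (u q) - u q m) by ring.
  rewrite (splitr eps); apply: le_lt_trans (ler_normB _ _) _.
  by apply: ltrD; exact: hN.
have [x sx] := (cvg_ex _).1 (seq_complete fX _ sc).
exists x; apply/funext => n; apply: (coord_cvg sx).
near=> k; rewrite /s seriesEord (val_unit_sum eE) ifT//.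
by near: k; exact: nbhs_infty_gt.
Unshelve. all: by end_near. Qed.

End Basis.

Section Shift.
Context {R : realType} {X : seqAlgebra R} {e : nat -> X}.
Hypothesis eE : forall n, \val (e n) = unit_seq R n.
Context {w : nat -> R[i]}.
Hypothesis w_neq0 : forall n, (0 < n)%N -> w n != 0.
Context {B : {linear X -> X}}.
Hypothesis BE : forall x, \val (B x) = backward_shift w (\val x).
Hypothesis bounded_B : continuous B.

(** The factor gained by the coordinate that [n] shifts bring to position [l]. *)
Definition wprod (w : nat -> R[i]) n l : R[i] :=
  \prod_(l.+1 <= j < (n + l).+1) w j.

Lemma wprod_neq0 n l : wprod w n l != 0.
Proof.
by apply: prod_nat_neq0 => i li; rewrite w_neq0// (leq_ltn_trans _ li).
Qed.

Lemma wprod0 l : wprod w 0 l = 1.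
Proof. by rewrite /wprod add0n big_geq. Qed.

Lemma wprodS n l : wprod w n.+1 l = w l.+1 * wprod w n l.+1.
Proof. by rewrite /wprod big_ltn ?ltnS ?leq_addl// addnS addSn. Qed.

Lemma val_iter_shift n x l : \val (iter n B x) l = wprod w n l * \val x (n + l)%N.
Proof.
elim: n l => [|n IH] l; first by rewrite wprod0 mul1r.
by rewrite iterS BE /backward_shift IH wprodS mulrA addnS.
Qed.

Lemma iter_shift_unit n l (c : R[i]) :
  iter n B (c *: e (n + l)%N) = (c * wprod w n l) *: e l.
Proof.
apply/val_inj/funext => m; rewrite val_iter_shift !valZ_coord !eE /unit_seq.
by rewrite eqn_add2l; case: eqVneq => [->|_]; rewrite ?mulr0// !mulr1 mulrC.
Qed.

Lemma continuous_iter_shift n : continuous (iter n B).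
Proof.
elim: n => [|n IH] x; first exact: cvg_id.
by apply: continuous_comp; [exact: IH|exact: bounded_B].
Qed.

Lemma iter_shift0 n : iter n B 0 = 0.
Proof. by elim: n => // n IH; rewrite iterS IH linear0. Qed.

End Shift.

(** * From a hypercyclic algebra to the weights *)

Section Necessity.
Context {R : realType} {X : seqAlgebra R} {e : nat -> X}.
Hypothesis eE : forall n, \val (e n) = unit_seq R n.
Hypothesis basis_e : schauder_basis e.
Context {q0 : nat}.
Hypothesis unit_ge1 : forall q n, (q0 <= q)%N -> 1 <= seqnorm q (e n).
Context {w : nat -> R[i]}.
Hypothesis w_neq0 : forall n, (0 < n)%N -> w n != 0.
Context {B : {linear X -> X}}.
Hypothesis BE : forall x, \val (B x) = backward_shift w (\val x).
Implicit Types (x y : X) (q : nat).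

(** Without a unit, powers start from [x] itself, so [m] products yield exponent [m.+1]. *)
Lemma val_seqpow x m n : \val (iter m (seqmul x) x) n = \val x n ^+ m.+1.
Proof.
elim: m => [|m IH]; first by rewrite expr1.
rewrite iterS exprS -IH; reflexivity.
Qed.

(** The general term of the convergent expansion is a difference of consecutive partial sums. *)
Lemma coord_unit_cvg0 x q (eps : R) : 0 < eps -> \forall n \near \oo,
  normc (\val x n) * seqnorm q (e n) < eps.
Proof.
move=> eps0; have e20 : 0 < eps / 2 by rewrite divr_gt0.
have h := unit_expansion eE basis_e unit_ge1 x q e20.
have [N _ hN] := h; exists N => // n /= Nn.
have hn := hN n Nn; have hn1 := hN n.+1 (leqW Nn).
rewrite -seqnormZ.
have -> : \val x n *: e n = (\sum_(i < n.+1) \val x i *: e i - x)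
    - (\sum_(i < n) \val x i *: e i - x).
  by rewrite big_ord_recr /= opprB addrA subrK addrAC subrr add0r.
rewrite (splitr eps); apply: le_lt_trans (seqnormD _ _ _) _.
by rewrite seqnormN ltrD.
Qed.

(* The coordinates of the target exceed those of the first [N] iterates, which
   forces the approximating iterate to come after them. *)
Lemma dense_orbit_shift x k N :
  hypercyclic_vectors B x ->
  exists2 n, (N <= n)%N & forall l, (l <= k)%N ->
    1 <= normc (wprod w n l * \val x (n + l)%N).
Proof.
move=> hx.
(* The summand 2 leaves the lower bound 1 after an approximation error less than 1. *)
pose t : R := 2 + \sum_(i < N) normc (\val (iter i B x) 0%N).
have t2 : 2 <= t by rewrite lerDl sumr_ge0// => i _; exact: normc_ge0.
pose z : X := \sum_(i < k.+1) (fun _ => t%:C) (i : nat) *: e i.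
pose O : set X := [set y | seqnorm q0 (y - z) < 1].
have zE l : (l <= k)%N -> \val z l = t%:C.
  by move=> lk; rewrite (val_unit_sum eE) ltnS lk.
have [|y [Oy [n _ yE]]] := hx O _ (@open_seqball R X q0 z 1); last rewrite -{y}yE in Oy.
  by exists z; rewrite /O /= subrr seqnorm0.
have big l : (l <= k)%N -> t - 1 < normc (\val (iter n B x) l).
  move=> lk; have : normc (\val (iter n B x) l - t%:C) < 1.
    rewrite -(zE l lk) -valB_coord; apply: le_lt_trans Oy.
    by apply: (normc_coord_le eE); exact: unit_ge1.
  have tt : normc t%:C = t by rewrite normc_real ger0_norm// (le_trans _ t2).
  move=> h.
  have := le_normcD (\val (iter n B x) l) (t%:C - \val (iter n B x) l).
  rewrite addrC subrK -[t%:C - _]opprB normcN tt; lra.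
exists n => [|l lk]; last first.
  by rewrite -(val_iter_shift BE); have := big l lk; lra.
rewrite leqNgt; apply/negP => nN; have := big 0%N (leq0n _).
rewrite /t (bigD1 (Ordinal nN))//= -addrA addrAC.
have : 0 <= \sum_(i < N | i != Ordinal nN) normc (\val (iter i B x) 0%N).
  by apply: sumr_ge0 => i _; exact: normc_ge0.
lra.
Qed.

(** Hypercyclicity of the power of exponent [k.+1] gives a late [n] at which the weight product to
    the power [- 1 / k.+1] is at most the modulus of the coordinate [n + l] of [x]; the latter times
    the seminorm of [e (n + l)] is small. *)
Lemma weight_decay_step x k : (forall m, hypercyclic_vectors B (iter m (seqmul x) x)) ->
  exists2 n, (0 < n)%N & forall l, (l <= k)%N ->
    normc (wprod w n l) `^ (- k.+1%:R^-1) * seqnorm (q0 + k) (e (n + l)%N)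
      <= k.+1%:R^-1.
Proof.
move=> hx; have k0 : 0 < k.+1%:R^-1 :> R by rewrite invr_gt0 ltr0n.
have [N _ hN] := coord_unit_cvg0 x (q0 + k) k0.
(* Asking for [N.+1] rather than [N] makes [n] positive. *)
have [n nN hn] := dense_orbit_shift k N.+1 (hx k).
exists n => [|l lk]; first exact: leq_trans nN.
have Nnl : (N <= n + l)%N by rewrite (leq_trans (ltnW nN))// leq_addr.
apply: le_trans (ltW (hN _ Nnl)); rewrite ler_wpM2r ?seqnorm_ge0//.
have := hn l lk; rewrite val_seqpow normcM normcX.
set P := normc _; set a := normc (\val x _) => h.
have P0 : 0 < P by rewrite normc_gt0 (wprod_neq0 w_neq0).
have a0 : 0 <= a by exact: normc_ge0.
have aE : a = (a ^+ k.+1) `^ k.+1%:R^-1.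
  by rewrite -powR_mulrn// -powRrM divff ?powRr1// pnatr_eq0.
rewrite powRN -[leLHS]mul1r ler_pdivrMr ?powR_gt0// aE -powRM ?exprn_ge0 ?(ltW P0)//.
have one : 1 `^ k.+1%:R^-1 = 1 :> R by rewrite powR1.
rewrite [_ * P]mulrC -[leLHS]one.
by apply: ge0_ler_powR; rewrite ?nnegrE ?(ltW k0)//; exact: le_trans h.
Qed.

(** All powers of a nonzero [x] in [A] are nonzero, hence hypercyclic. The diagonal choice [n k]
    handles every [gamma], [l] and [q] once [k] exceeds [l], [q] and the inverse of [gamma]. *)
Lemma necessity A : hypercyclic_algebra B A ->
  exists2 n : nat -> nat, (forall k, (0 < n k)%N) &
     forall (gamma : R) (l : nat), 0 < gamma ->
     forall c : nat -> R[i],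
       (forall k, cpow_determination
          (\prod_(l.+1 <= j < (n k + l).+1) w j) (- gamma) (c k)) ->
       c k *: e (n k + l)%N @[k --> \oo] --> (0 : X).
Proof.
move=> [[A0 _ _ AM] An0 Ah].
have [x Ax x0] : exists2 x, A x & x <> 0.
  apply: contrapT => h; apply: An0; apply/seteqP; split => [y Ay|_ ->//].
  by apply: contrapT => y0; apply: h; exists y.
have hx m : hypercyclic_vectors B (iter m (seqmul x) x).
  have Am : A (iter m (seqmul x) x) by elim: m => // m IH; exact: AM.
  have [//|xm0] := Ah _ Am; case: x0; apply/val_inj/funext => n.
  have /eqP : \val x n ^+ m.+1 = 0 by rewrite -val_seqpow (xm0 : _ = 0).
  by rewrite expf_eq0 => /eqP ->.
pose P k n := (0 < n)%N /\ forall l, (l <= k)%N ->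
    normc (wprod w n l) `^ (- k.+1%:R^-1) * seqnorm (q0 + k) (e (n + l)%N)
      <= k.+1%:R^-1.
have [n nP] : {n : nat -> nat & forall k, P k (n k)}.
  by apply: choice => k; have [m m0 hm] := weight_decay_step k hx; exists m.
exists n => [k|gamma l g0 c hc]; first by have [] := nP k.
apply/cvg_seqnormP => q eps eps0; near=> k.
rewrite subr0 seqnormZ (normc_cpow (hc k)) -/(wprod w _ _).
have [n0 /(_ l)] := nP k.
have -> : (l <= k)%N by near: k; exact: nbhs_infty_ge.
move=> /(_ isT) h.
set a := normc _ in h *.
have a0 : 0 < a by rewrite normc_gt0 (wprod_neq0 w_neq0).
have p1 : 1 <= seqnorm (q0 + k) (e (n k + l)%N) by rewrite unit_ge1// leq_addr.
have k1 : k.+1%:R^-1 <= gamma.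
  rewrite -[gamma]invrK lef_pV2 ?posrE ?invr_gt0 ?ltr0n//.
  near: k; have := nbhs_infty_ger gamma^-1; apply: filterS => j hj.
  by apply: le_trans hj _; rewrite ler_nat.
(* The seminorm of the unit vector is at least 1, so the bound [h] forces [1 <= a]; this permits
   replacing the exponent [- 1 / k.+1] by the smaller [- gamma]. *)
have a1 : 1 <= a.
  have : a `^ (- k.+1%:R^-1) <= 1.
    apply: le_trans (_ : _ <= k.+1%:R^-1) _; last by rewrite invf_le1 ?ltr0n ?ler1n.
    by apply: le_trans h; rewrite ler_peMr// powR_ge0.
  rewrite powRN invf_le1 ?powR_gt0// => h1; rewrite leNgt; apply/negP => a1.
  have : a `^ k.+1%:R^-1 < 1.
    have one : 1 `^ k.+1%:R^-1 = 1 :> R by rewrite powR1.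
    rewrite -[ltRHS]one.
    by apply: gt0_ltr_powR; rewrite ?invr_gt0 ?ltr0n ?nnegrE// ltW.
  by rewrite ltNge h1.
apply: le_lt_trans (_ : _ <= k.+1%:R^-1) _.
  apply: le_trans h; apply: ler_pM; rewrite ?powR_ge0 ?seqnorm_ge0//.
    by apply: ler_powR => //; rewrite lerN2.
  apply: seqnorm_homo; apply: leq_trans (leq_addl q0 k).
  by near: k; exact: nbhs_infty_ge.
rewrite -[eps]invrK ltf_pV2 ?posrE ?invr_gt0 ?ltr0n//.
near: k; have := nbhs_infty_ger eps^-1; apply: filterS => j hj.
by apply: le_lt_trans hj _; rewrite ltr_nat.
Unshelve. all: by end_near. Qed.

End Necessity.

(** * Blocks of coordinates *)

Section Stage.
Context {R : realType} {X : seqAlgebra R} {e : nat -> X}.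
Hypothesis eE : forall n, \val (e n) = unit_seq R n.
Context {q0 : nat}.
Hypothesis unit_ge1 : forall q n, (q0 <= q)%N -> 1 <= seqnorm q (e n).
Context {w : nat -> R[i]}.
Hypothesis w_neq0 : forall n, (0 < n)%N -> w n != 0.
Context {B : {linear X -> X}}.
Hypothesis BE : forall x, \val (B x) = backward_shift w (\val x).
Hypothesis bounded_B : continuous B.
Context {n : nat -> nat}.
Hypothesis n_decay : forall (gamma : R) (l : nat), 0 < gamma -> (0 < l)%N ->
     forall c : nat -> R[i],
       (forall k, cpow_determination
          (\prod_(l.+1 <= j < (n k + l).+1) w j) (- gamma) (c k)) ->
       c k *: e (n k + l)%N @[k --> \oo] --> (0 : X).

(* Passing from [n k] to [(n k).+1] turns the range [0 < l] into [0 <= l]. *)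
Lemma succ_decay (gamma : R) l q (eps : R) : 0 < gamma -> 0 < eps ->
  \forall k \near \oo, normc (wprod w (n k).+1 l) `^ (- gamma)
    * seqnorm q (e ((n k).+1 + l)%N) < eps.
Proof.
move=> g0 eps0.
have [c hc] : {c : nat -> R[i] & forall k,
    cpow_determination (wprod w (n k) l.+1) (- gamma) (c k)}.
  apply: (@choice _ _ (fun k => cpow_determination (wprod w (n k) l.+1) _)) => k.
  by apply: cpow_determination_exists; exact: wprod_neq0.
have /cvg_seqnormP h := n_decay g0 (ltn0Sn l) hc.
(* By [wprodS] the two weight products differ by the factor [w l.+1], whose power is absorbed into
   [eps]. *)
set a := normc (w l.+1).
have a0 : 0 < a by rewrite normc_gt0 w_neq0.
have ag : 0 < a `^ (- gamma) by rewrite powR_gt0.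
have := h q (eps / a `^ (- gamma)) (divr_gt0 eps0 ag); apply: filterS => k.
rewrite subr0 seqnormZ (normc_cpow (hc k)) ltr_pdivlMr// mulrC mulrA.
by rewrite wprodS normcM powRM ?normc_ge0// addSnnS.
Qed.

(** Monotonicity of [n] is not given; but a value taken infinitely often would keep the decaying
    quantity, at [gamma = 1] and [l = 0], above a fixed positive number. *)
Lemma succ_ge M : \forall k \near \oo, (M <= (n k).+1)%N.
Proof.
have h (i : 'I_M) : \forall k \near \oo, ((n k).+1 != i)%N.
  have i0 : 0 < normc (wprod w i 0) `^ (-1).
    by rewrite powR_gt0// normc_gt0 (wprod_neq0 w_neq0).
  have := succ_decay 0 q0 ltr01 i0; apply: filterS => k.
  apply: contraTneq => ->; rewrite -leNgt -[leLHS]mulr1 ler_pM2l//.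
  exact: unit_ge1.
have hF : \forall k \near \oo, forall i : 'I_M, ((n k).+1 != i)%N.
  exact: filter_forall.
apply: filterS hF => k hk.
by rewrite leqNgt; apply/negP => nM; have := hk (Ordinal nM); rewrite eqxx.
Qed.

(** Take [N = (n k).+1] with [k] large. The first bound says that up to [M] shifts keep the entries
    of index 2 small; the second, that the shift by [N] makes those of index [b.+1] small. Each
    amounts to finitely many conditions that hold eventually. *)
Lemma exists_stage b (v : nat -> R[i]) L M q (eta : R) : (1 < b)%N -> 0 < eta ->
  exists N, [/\ (M <= N)%N,
    forall i l, (i <= M)%N -> (l < L)%N ->
      normc (wprod w i (N + l - i)) * normc (natchar (v l / wprod w N l) b 2)
        * seqnorm q (e (N + l - i)%N) <= eta &
    forall l, (l < L)%N ->
      normc (wprod w N l) * normc (natchar (v l / wprod w N l) b b.+1)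
        * seqnorm q (e l) <= eta].
Proof.
move=> b1 eta0.
have lnb : 0 < ln b%:R :> R by rewrite ln_gt0// ltr1n.
have zE (s : R) N l : normc (v l / wprod w N l) `^ s =
    normc (v l) `^ s * normc (wprod w N l) `^ (- s).
  rewrite normcM normcV powRM ?invr_ge0 ?normc_ge0//.
  by rewrite -powR_inv1 ?normc_ge0// -powRrM mulN1r.
have hA (il : 'I_M.+1 * 'I_L) : \forall k \near \oo,
    (il.1 <= (n k).+1)%N ->
    normc (wprod w il.1 ((n k).+1 + il.2 - il.1)) *
    normc (natchar (v il.2 / wprod w (n k).+1 il.2) b 2)
        * seqnorm q (e ((n k).+1 + il.2 - il.1)%N) <= eta.
  case: il => i l /=; pose g : R := ln 2%:R / ln b%:R.
  have g0 : 0 < g by rewrite divr_gt0// ln_gt0// ltr1n.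
  (* Continuity of the [i]-th iterate reduces the bound to the unshifted vector, which decays with
     exponent [ln 2 / ln b]. *)
  have [q' [del [del0 hdel]]] := continuous_seqnorm
    (continuous_iter_shift bounded_B (n := i)) (iter_shift0 _) q eta0.
  (* The added 1 keeps the divisor positive even when [v l] vanishes. *)
  pose a := normc (v l) `^ g + 1.
  have a0 : 0 < a by rewrite ltr_wpDl ?powR_ge0.
  have := succ_decay l q' g0 (divr_gt0 del0 a0); apply: filterS => k hk ik.
  have ilk : (i <= (n k).+1 + l)%N by rewrite (leq_trans ik)// leq_addr.
  set z := natchar _ _ _; set N := (n k).+1.
  have := hdel (z *: e (i + (N + l - i))%N).
  rewrite (iter_shift_unit eE BE) !seqnormZ normcM [_ * normc (wprod _ _ _)]mulrC.
  move=> H; apply: ltW; apply: H.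
  rewrite subnKC// /z normc_natchar// zE -mulrA.
  apply: le_lt_trans (_ : a * (normc (wprod w N l) `^ (- g) * seqnorm q' (e (N + l)%N)) < _).
    by rewrite ler_wpM2r ?mulr_ge0 ?powR_ge0 ?seqnorm_ge0// lerDl.
  by rewrite mulrC -ltr_pdivlMr.
have hB (l : 'I_L) : \forall k \near \oo,
    normc (wprod w (n k).+1 l) *
    normc (natchar (v l / wprod w (n k).+1 l) b b.+1) * seqnorm q (e l) <= eta.
  (* As [s > 1], the weight product [P] enters with the negative exponent [- (s - 1)], so decay
     applies with [gamma = s - 1]. *)
  pose s : R := ln b.+1%:R / ln b%:R.
  have s1 : 0 < s - 1.
    rewrite subr_gt0 ltr_pdivlMr// mul1r ltr_ln ?posrE ?ltr0n ?ltr_nat//.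
    exact: ltnW.
  pose a := normc (v l) `^ s * seqnorm q (e l) + 1.
  have a0 : 0 < a by rewrite ltr_wpDl ?mulr_ge0 ?powR_ge0 ?seqnorm_ge0.
  have := succ_decay l q0 s1 (divr_gt0 eta0 a0); apply: filterS => k.
  set N := (n k).+1; set P := normc (wprod _ _ _) => hk.
  have P0 : 0 < P by rewrite normc_gt0 (wprod_neq0 w_neq0).
  rewrite normc_natchar// zE -/P -/s.
  have PE : P * P `^ (- s) = P `^ (- (s - 1)).
    rewrite opprB powRD ?powRr1 ?ltW//; apply/implyP => _; exact: lt0r_neq0.
  have -> : P * (normc (v l) `^ s * P `^ (- s)) * seqnorm q (e l) =
     normc (v l) `^ s * seqnorm q (e l) * P `^ (- (s - 1)) by rewrite -PE; ring.
  have hk' : P `^ (- (s - 1)) < eta / a.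
    apply: le_lt_trans hk; rewrite ler_peMr ?powR_ge0//; exact: unit_ge1.
  apply: le_trans (_ : a * P `^ (- (s - 1)) <= _).
    by rewrite ler_wpM2r ?powR_ge0// lerDl.
  by rewrite mulrC -ler_pdivlMr// ltW.
have [k [[hM hA'] hB']] := filter_ex (filterI (filterI (succ_ge M)
  (filter_forall _ hA)) (filter_forall _ hB)).
exists (n k).+1; split => // [i l iM lL|l lL]; last exact: (hB' (Ordinal lL)).
by apply: (hA' (Ordinal (iM : (i < M.+1)%N), Ordinal lL)); exact: leq_trans hM.
Qed.

End Stage.

(** * Sums over consecutive intervals of positions *)

Section Blocks.
Context {R : realType}.

Lemma sum_block_le (F : nat -> R) a c L b (eta S : R) :
  (a <= c)%N -> (c + L <= b)%N ->
  (forall m, (a <= m < c)%N -> F m = 0) ->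
  (forall m, (c + L <= m < b)%N -> F m = 0) ->
  (forall l, (l < L)%N -> F (c + l)%N <= eta) -> L%:R * eta <= S ->
  \sum_(a <= m < b) F m <= S.
Proof.
move=> ac cb F1 F2 F3 etaS.
rewrite (big_cat_nat ac) /= //; last exact: leq_trans (leq_addr _ _) cb.
rewrite [X in X + _]big_nat [X in X + _]big1 ?add0r//.
rewrite (big_cat_nat (leq_addr L c)) //=.
rewrite [X in _ + X]big_nat [X in _ + X]big1 ?addr0//.
apply: le_trans etaS; rewrite -{1}[c]add0n big_addn addKn.
rewrite mulr_natl -[L in leRHS]subn0 -sumr_const_nat big_nat [leRHS]big_nat.
by apply: ler_sum => l /andP[_ lL]; rewrite addnC F3.
Qed.

Variable M : nat -> nat.
Hypothesis MS : forall j, (M j < M j.+1)%N.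

Lemma start_mono i j : (i <= j)%N -> (M i <= M j)%N.
Proof.
elim: j => [|j IH]; first by rewrite leqn0 => /eqP ->.
rewrite leq_eqVlt => /orP[/eqP -> //|]; rewrite ltnS => /IH h.
by apply: leq_trans h _; exact: ltnW.
Qed.

Lemma start_ge j : (j <= M j)%N.
Proof. by elim: j => // j IH; apply: leq_ltn_trans IH _. Qed.

Lemma block_index : exists blk : nat -> nat,
  forall m j, (M j <= m < M j.+1)%N -> blk m = j.
Proof.
have h m : exists j, forall i, (M i <= m < M i.+1)%N -> j = i.
  have ex : exists j, (m < M j.+1)%N by exists m; exact: start_ge.
  exists (ex_minn ex) => i /andP[Mi Mi1]; case: ex_minnP => j mj jmin.
  apply/eqP; rewrite eqn_leq jmin//=; rewrite leqNgt; apply/negP => ji.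
  by have := leq_trans mj (start_mono ji); rewrite ltnNge Mi.
have [blk hblk] := @choice _ _ (fun m j => forall i, (M i <= m < M i.+1)%N -> j = i) h.
by exists blk => m j; exact: hblk.
Qed.

(** Extend the sum to whole blocks, up to [M (j + K) >= K], and add the geometric bounds. *)
Lemma sum_blocks_le (h : nat -> R) j K : (forall m, 0 <= h m) ->
  (forall i, (j <= i)%N -> \sum_(M i <= m < M i.+1) h m <= 2^-1 ^+ i.+1) ->
  \sum_(M j <= m < K) h m <= 2^-1 ^+ j.
Proof.
move=> h0 hi; apply: le_trans (_ : \sum_(M j <= m < M (j + K)) h m <= _).
  have KM : (K <= M (j + K))%N by rewrite (leq_trans _ (start_ge _))// leq_addl.
  have [jK|Kj] := leqP (M j) K.
    by rewrite [leRHS](big_cat_nat jK)//= lerDl sumr_ge0.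
  by rewrite big_geq ?(ltnW Kj)// sumr_ge0.
suff : \sum_(M j <= m < M (j + K)) h m <= 2^-1 ^+ j - 2^-1 ^+ (j + K).
  by move=> H; apply: le_trans H _; rewrite gerBl exprn_ge0// invr_ge0.
elim: K => [|K IH]; first by rewrite addn0 big_geq// subrr.
rewrite addnS (big_cat_nat (start_mono (leq_addr K j)) (ltnW (MS _)))//=.
have := lerD IH (hi (j + K)%N (leq_addr _ _)).
move=> H; apply: le_trans H _; rewrite exprS; lra.
Qed.

End Blocks.

(** * Recursive construction of the coordinate characters *)

Section Tower.
Context {R : realType} {X : seqAlgebra R}.
Implicit Types (e : nat -> X) (w : nat -> R[i]) (bt M N L : nat -> nat).
Implicit Types (v chi : nat -> nat -> R[i]).

(* The coordinates are cut into blocks [[M j, M j.+1[], and the [a]-th vector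
   of the tower has coordinates [chi m a]. The shift by [N j] maps block [j] of
   the [bt j]-th vector to the target [v j], while it makes negligible both the
   later blocks and block [j] of the [a]-th vectors, [a > bt j]. *)
Record character_tower e w q0 bt v M N chi : Prop := CharacterTower {
  tower_M0 : M 0 = 0%N ;
  tower_MS : forall j, (M j < M j.+1)%N ;
  tower_N : forall j, (M j <= N j < M j.+1)%N ;
  tower_chi1 : forall m, chi m 1%N = 1 ;
  tower_chiM : forall m a a', (0 < a)%N -> (0 < a')%N ->
    chi m (a * a')%N = chi m a * chi m a' ;
  tower_decay : forall m a, (1 < a)%N ->
    normc (chi m a) <= 2 / a%:R * normc (chi m 2) ;
  tower_small : forall j i, (i <= M j)%N ->
    \sum_(M j <= m < M j.+1) normc (wprod w i (m - i)) * normc (chi m 2)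
      * seqnorm (q0 + j) (e (m - i)%N) <= 2^-1 ^+ j.+1 ;
  tower_target : forall j l, (N j + l < M j.+1)%N ->
    wprod w (N j) l * chi (N j + l)%N (bt j) = v j l ;
  tower_target0 : forall j l, (M j.+1 <= N j + l)%N -> v j l = 0 ;
  tower_anti : forall j m a, (M j <= m < M j.+1)%N -> (bt j < a)%N ->
    normc (chi m a) <= normc (chi m (bt j).+1) ;
  tower_higher : forall j,
    \sum_(N j <= m < M j.+1) normc (wprod w (N j) (m - N j))
      * normc (chi m (bt j).+1) * seqnorm (q0 + j) (e (m - N j)%N)
      <= 2^-1 ^+ j.+1 }.

Context {e : nat -> X}.
Hypothesis eE : forall n, \val (e n) = unit_seq R n.
Context {q0 : nat}.
Hypothesis unit_ge1 : forall q n, (q0 <= q)%N -> 1 <= seqnorm q (e n).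
Context {w : nat -> R[i]}.
Hypothesis w_neq0 : forall n, (0 < n)%N -> w n != 0.
Context {B : {linear X -> X}}.
Hypothesis BE : forall x, \val (B x) = backward_shift w (\val x).
Hypothesis bounded_B : continuous B.
Context {n : nat -> nat}.
Hypothesis n_decay : forall (gamma : R) (l : nat), 0 < gamma -> (0 < l)%N ->
     forall c : nat -> R[i],
       (forall k, cpow_determination
          (\prod_(l.+1 <= j < (n k + l).+1) w j) (- gamma) (c k)) ->
       c k *: e (n k + l)%N @[k --> \oo] --> (0 : X).

(** Block [j] starts where block [j - 1] ends, and [exists_stage] places its window of length [L j]
    far enough. Outside the windows the base value is 0, so [chi] vanishes at every index above
    1. *)
Lemma exists_tower bt v L : (forall j, 1 < bt j)%N ->
  (forall j l, (L j <= l)%N -> v j l = 0) ->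
  exists M N chi, character_tower e w q0 bt v M N chi.
Proof.
move=> bt1 v0.
(* The bound for a block is shared among its [L j] window entries; [.+1] avoids a zero divisor. *)
pose eta j : R := 2^-1 ^+ j.+1 / (L j).+1%:R.
have eta0 j : 0 < eta j by rewrite divr_gt0// exprn_gt0// invr_gt0.
have etaL j : (L j)%:R * eta j <= 2^-1 ^+ j.+1.
  rewrite mulrC -mulrA ler_piMr ?exprn_ge0 ?invr_ge0//.
  by rewrite ler_pdivrMl ?ltr0n// mulr1 ler_nat.
(* A stage is chosen for every possible starting point, so that the starting points can then be
   defined by recursion. *)
have [St hSt] : {St : nat * nat -> nat & forall jM, [/\ (jM.2 <= St jM)%N,
    forall i l, (i <= jM.2)%N -> (l < L jM.1)%N ->
      normc (wprod w i (St jM + l - i))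
        * normc (natchar (v jM.1 l / wprod w (St jM) l) (bt jM.1) 2)
        * seqnorm (q0 + jM.1) (e (St jM + l - i)%N) <= eta jM.1 &
    forall l, (l < L jM.1)%N ->
      normc (wprod w (St jM) l)
        * normc (natchar (v jM.1 l / wprod w (St jM) l) (bt jM.1) (bt jM.1).+1)
        * seqnorm (q0 + jM.1) (e l) <= eta jM.1]}.
  pose P (jM : nat * nat) (N : nat) := [/\ (jM.2 <= N)%N,
    forall i l, (i <= jM.2)%N -> (l < L jM.1)%N ->
      normc (wprod w i (N + l - i))
        * normc (natchar (v jM.1 l / wprod w N l) (bt jM.1) 2)
        * seqnorm (q0 + jM.1) (e (N + l - i)%N) <= eta jM.1 &
    forall l, (l < L jM.1)%N ->
      normc (wprod w N l)
        * normc (natchar (v jM.1 l / wprod w N l) (bt jM.1) (bt jM.1).+1)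
        * seqnorm (q0 + jM.1) (e l) <= eta jM.1].
  apply: (@choice _ _ P) => -[j M].
  exact: (exists_stage eE unit_ge1 w_neq0 BE bounded_B n_decay).
(* The successor keeps [N j] inside block [j] even when the window is empty. *)
pose M := fix M j := if j is j'.+1 then (St (j', M j') + L j').+1 else 0%N.
pose N j := St (j, M j).
have MSE j : M j.+1 = (N j + L j).+1 by [].
have MN j : (M j <= N j)%N by have [] := hSt (j, M j).
have MS j : (M j < M j.+1)%N by rewrite MSE ltnS (leq_trans (MN j))// leq_addr.
have [blk blkE] := block_index MS.
pose z m := if (N (blk m) <= m)%N then
  v (blk m) (m - N (blk m))%N / wprod w (N (blk m)) (m - N (blk m)) else 0.
pose chi m := natchar (z m) (bt (blk m)).
have blkP m : (M (blk m) <= m < M (blk m).+1)%N.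
  suff [j hj] : exists j, (M j <= m < M j.+1)%N by rewrite (blkE _ _ hj).
  elim: m => [|m [j /andP[Mj]]]; first by exists 0%N; rewrite MSE.
  rewrite leq_eqVlt => /orP[/eqP jE|jM]; last by exists j; rewrite (leqW Mj).
  by exists j.+1; rewrite jE leqnn MS.
have zN j m : (M j <= m < N j)%N -> z m = 0 /\ blk m = j.
  move=> /andP[Mm mN]; have bj : blk m = j.
    by apply: blkE; rewrite Mm MSE ltnS (leq_trans (ltnW mN))// leq_addr.
  by rewrite /z bj leqNgt mN.
have zE j l : (N j + l < M j.+1)%N ->
    z (N j + l)%N = v j l / wprod w (N j) l /\ blk (N j + l)%N = j.
  move=> lM; have bj : blk (N j + l)%N = j.
    by apply: blkE; rewrite lM (leq_trans (MN j))// leq_addr.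
  by rewrite /z bj leq_addr addKn.
have zL j m : (N j + L j <= m < M j.+1)%N -> z m = 0.
  move=> /andP[NLm mM]; have Nm : (N j <= m)%N by rewrite (leq_trans _ NLm)// leq_addr.
  rewrite -(subnKC Nm); rewrite (zE j _ _).1 ?subnKC//.
  by rewrite v0 ?mul0r// leq_subRL.
have chi0 m a : (1 < a)%N -> z m = 0 -> chi m a = 0.
  by move=> a1 z0; rewrite /chi z0 /natchar eqxx gtn_eqF.
have chiE j l a : (l < L j)%N ->
    chi (N j + l)%N a = natchar (v j l / wprod w (N j) l) (bt j) a.
  move=> lL; have [|zl bl] := zE j l; first by rewrite MSE ltnS leq_add2l ltnW.
  by rewrite /chi zl bl.
have small j i : (i <= M j)%N ->
    \sum_(M j <= m < M j.+1) normc (wprod w i (m - i)) * normc (chi m 2)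
      * seqnorm (q0 + j) (e (m - i)%N) <= 2^-1 ^+ j.+1.
  move=> iM; have [_ hj _] := hSt (j, M j).
  apply: (@sum_block_le _ _ _ (N j) (L j) _ (eta j)); rewrite ?MSE//.
  - by move=> m hm; rewrite chi0 ?(zN _ _ hm).1// normc0 mulr0 mul0r.
  - by move=> m hm; rewrite chi0 ?(zL j)// normc0 mulr0 mul0r.
  - by move=> l lL; rewrite chiE//; exact: hj.
have half1 : 2^-1 <= 1 :> R by rewrite invf_le1 ?ler1n.
(* A single term of the sum in [small], taken with no shift, already gives this, the seminorm of
   [e m] being at least 1. *)
have chi2 m : normc (chi m 2) <= 2^-1.
  apply: le_trans (_ : _ <= 2^-1 ^+ (blk m).+1) _; last first.
    by rewrite exprS ler_piMr ?invr_ge0// exprn_ile1 ?invr_ge0.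
  have /andP[Mm mM] := blkP m.
  have := small (blk m) 0%N (leq0n _).
  rewrite (big_cat_nat Mm (ltnW mM))//= (big_ltn mM).
  rewrite subn0 wprod0 normc1 mul1r.
  set s1 := \sum_(_ <= _ < m) _; set s2 := \sum_(_ <= _ < _) _ => h.
  have s10 : 0 <= s1 by rewrite sumr_ge0// => i _; rewrite ?mulr_ge0 ?normc_ge0 ?seqnorm_ge0.
  have s20 : 0 <= s2 by rewrite sumr_ge0// => i _; rewrite ?mulr_ge0 ?normc_ge0 ?seqnorm_ge0.
  have : normc (chi m 2) <= normc (chi m 2) * seqnorm (q0 + blk m) (e m).
    by rewrite ler_peMr ?normc_ge0// unit_ge1// leq_addr.
  lra.
have z1 m : normc (z m) <= 1.
  apply: (normc_natchar_le1 (bt1 (blk m))).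
  exact: le_trans (chi2 m) half1.
exists M, N, chi; split => //.
- by move=> j; rewrite MN MSE ltnS leq_addr.
- by move=> m; exact: natchar1.
- by move=> m a a'; exact: natcharM.
- by move=> m a a1; apply: normc_natchar_decay => //; exact: chi2.
- move=> j l lM; have [zl bl] := zE j l lM.
  by rewrite /chi zl bl natchar_base// mulrC divfK// (wprod_neq0 w_neq0).
- move=> j l; rewrite MSE => h; apply: v0.
  by have := ltnW h; rewrite leq_add2l.
- move=> j m a hm ba; rewrite /chi (blkE _ _ hm).
  exact: normc_natchar_anti.
- move=> j; have [_ _ hj] := hSt (j, M j).
  apply: (@sum_block_le _ _ _ (N j) (L j) _ (eta j)); rewrite ?MSE//.
  + by move=> m /andP[h1 h2]; have := leq_ltn_trans h1 h2; rewrite ltnn.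
  + move=> m hm; rewrite chi0 ?(zL j)// ?normc0 ?mulr0 ?mul0r//.
    by rewrite ltnS ltnW.
  + by move=> l lL; rewrite chiE// addKn; exact: hj.
Qed.

End Tower.

(** * Multiplicative spans and hypercyclic combinations *)

Section RationalApproximation.
Context {R : realType}.

Definition ratc (r : rat * rat) : R[i] := ratr r.1 +i* ratr r.2.

(** Lists of rational pairs form a countable type, so the targets can be enumerated by the
    stages. *)
Definition ratseq (s : seq (rat * rat)) (l : nat) : R[i] := ratc (nth (0, 0) s l).

Lemma ratseq_default s l : (size s <= l)%N -> ratseq s l = 0.
Proof. by move=> sl; rewrite /ratseq nth_default// /ratc/= !rmorph0. Qed.

Lemma ratc_dense (z : R[i]) (eps : R) : 0 < eps ->
  exists r, normc (ratc r - z) < eps.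
Proof.
case: z => x y eps0; have e2 : 0 < eps / 2 by rewrite divr_gt0.
have near_rat (t : R) : exists r : rat, `|ratr r - t| < eps / 2.
  have [|r] := @rat_in_itvoo R (t - eps / 2) (t + eps / 2).
    by rewrite ltrD2l gtrN.
  by rewrite in_itv/= => h; exists r; rewrite ltr_distl.
have [a ha] := near_rat x; have [b hb] := near_rat y; exists (a, b).
rewrite (_ : _ - _ = (ratr a - x)%:C + 'i%C * (ratr b - y)%:C); last first.
  by apply/eqP; rewrite eq_complex /=; apply/andP; split; apply/eqP; ring.
apply: le_lt_trans (le_normcD _ _) _; rewrite normcM !normc_real.
rewrite [normc 'i%C]/= expr0n expr1n add0r sqrtr1 mul1r (splitr eps).
exact: ltrD.
Qed.

Context {X : seqAlgebra R} {e : nat -> X}.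
Hypothesis eE : forall n, \val (e n) = unit_seq R n.
Hypothesis basis_e : schauder_basis e.
Context {q0 : nat}.
Hypothesis unit_ge1 : forall q n, (q0 <= q)%N -> 1 <= seqnorm q (e n).

(** Truncate the expansion, then round each of the [K] coordinates with the tolerance [del]. *)
Lemma ratseq_dense (x : X) q (eps : R) : 0 < eps -> exists s,
  seqnorm q (\sum_(i < size s) ratseq s i *: e i - x) < eps.
Proof.
move=> eps0; have e2 : 0 < eps / 2 by rewrite divr_gt0.
have [K hK] := filter_ex (unit_expansion eE basis_e unit_ge1 x q e2).
pose del i : R := eps / 2 / (K.+1%:R * (seqnorm q (e i) + 1)).
have ne0 i : 0 < seqnorm q (e i) + 1 by rewrite ltr_wpDl ?seqnorm_ge0.
have del0 i : 0 < del i by rewrite divr_gt0// mulr_gt0.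
have [r hr] : {r : nat -> rat * rat & forall i,
    normc (ratc (r i) - \val x i) < del i}.
  apply: (@choice _ _ (fun i r => normc (ratc r - \val x i) < del i)) => i.
  exact: ratc_dense.
exists (mkseq r K); rewrite size_mkseq.
rewrite -(subrK (\sum_(i < K) \val x i *: e i) (\sum_(i < K) ratseq _ i *: _)).
rewrite -addrA (splitr eps); apply: le_lt_trans (seqnormD _ _ _) _.
apply: ler_ltD => //; rewrite -sumrB; apply: le_trans (seqnorm_sum _ _ _ _) _.
apply: le_trans (_ : \sum_(i < K) eps / 2 / K.+1%:R <= _); last first.
  rewrite sumr_const card_ord -[leLHS]mulr_natr -mulrA ler_piMr ?(ltW e2)//.
  by rewrite ler_pdivrMl// mulr1 ler_nat.
apply: ler_sum => i _; rewrite -scalerBl seqnormZ /ratseq nth_mkseq//.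
apply: le_trans (_ : del i * (seqnorm q (e i) + 1) <= _).
  by apply: ler_pM; rewrite ?normc_ge0 ?seqnorm_ge0 ?(ltW (hr _)) ?lerDl.
by rewrite /del invfM mulrA -mulrA mulVf ?mulr1// gt_eqF.
Qed.

End RationalApproximation.

Lemma increasing_primes : exists pr : nat -> nat,
  (forall m, prime (pr m)) /\ forall m, (pr m < pr m.+1)%N.
Proof.
pose pr := fix pr m := if m is m'.+1 then s2val (prime_above (pr m')) else 2%N.
exists pr; split=> [[|m] //|m]; rewrite /=; first exact: s2valP' (prime_above _).
exact: s2valP (prime_above _).
Qed.

(** The exponent of 2 in [j] carries the code, and a power of 3 enlarges [j] without changing it;
    each code thus recurs at arbitrarily late stages. *)
Lemma recurring_code (T : countType) (x0 x : T) J : exists2 j, (J <= j)%N &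
  odflt x0 (unpickle (logn 2 j)) = x.
Proof.
exists (3 ^ J * 2 ^ pickle x)%N.
  by rewrite (leq_trans (ltnW (ltn_expl J (isT : 1 < 3)%N)))// leq_pmulr// expn_gt0.
by rewrite logn_Gauss ?coprimeXr// pfactorK// pickleK.
Qed.

Section Span.
Context {R : realType} {X : seqAlgebra R}.
Implicit Types (f : nat -> X) (S : set nat).

Definition comb_supp (c : nat -> R[i]) S K := forall a, c a != 0 -> S a /\ (a < K)%N.

Definition spanset f S : set X :=
  [set x | exists c K, comb_supp c S K /\ x = \sum_(a < K) c a *: f a].

Lemma comb_widen f c S K K' : (K <= K')%N -> comb_supp c S K ->
  \sum_(a < K) c a *: f a = \sum_(a < K') c a *: f a.
Proof.
move=> KK' cS; rewrite -!(big_mkord xpredT (fun a => c a *: f a)).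
rewrite [RHS](big_cat_nat _ KK')//= [X in _ + X]big_nat [X in _ + X]big1 ?addr0//.
move=> a /andP[Ka _]; have [->|/cS[_]] := eqVneq (c a) 0; first by rewrite scale0r.
by rewrite ltnNge Ka.
Qed.

Lemma spanset_gen f S a : S a -> spanset f S (f a).
Proof.
move=> Sa; exists (fun b => (b == a)%:R), a.+1; split.
  by move=> b; rewrite pnatr_eq0 eqb0 negbK => /eqP ->.
rewrite big_ord_recr /= eqxx scale1r big1 ?add0r// => i _.
by rewrite ltn_eqF ?scale0r.
Qed.

Lemma spansetD f S x y : spanset f S x -> spanset f S y -> spanset f S (x + y).
Proof.
move=> [c [K [cS ->]]] [d [L [dS ->]]]; exists (fun a => c a + d a), (maxn K L).
split.
  move=> a; have [-> |/cS[Sa aK] _] := eqVneq (c a) 0; last by rewrite leq_max aK.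
  by rewrite add0r => /dS[Sa aL]; rewrite leq_max aL orbT.
rewrite (comb_widen f (leq_maxl K L) cS) (comb_widen f (leq_maxr K L) dS).
by rewrite -big_split; apply: eq_bigr => i _; rewrite scalerDl.
Qed.

Lemma spansetZ f S c x : spanset f S x -> spanset f S (c *: x).
Proof.
move=> [d [K [dS ->]]]; exists (fun a => c * d a), K; split.
  by move=> a; rewrite mulf_eq0 negb_or => /andP[_ /dS].
by rewrite scaler_sumr; apply: eq_bigr => i _; rewrite scalerA.
Qed.

Lemma spanset0 f S : spanset f S 0.
Proof.
by exists (fun=> 0), 0%N; split => [a|]; rewrite ?eqxx// big_ord0.
Qed.

Lemma spanset_sum f S (I : Type) (s : seq I) (F : I -> X) :
  (forall i, spanset f S (F i)) -> spanset f S (\sum_(i <- s) F i).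
Proof.
by move=> h; elim/big_ind: _ => //; [exact: spanset0|exact: spansetD].
Qed.

Lemma spansetS f S S' : S `<=` S' -> spanset f S `<=` spanset f S'.
Proof.
move=> SS x [c [K [cS ->]]]; exists c, K; split => // a /cS[Sa aK].
by split => //; exact: SS.
Qed.

Lemma spanset_subalgebra f S :
  (forall a b, S a -> S b -> S (a * b)%N /\ seqmul (f a) (f b) = f (a * b)%N) ->
  subalgebra (spanset f S).
Proof.
move=> SM; split; [exact: spanset0|exact: spansetD| |].
  by move=> c x; exact: spansetZ.
move=> x y [c [K [cS ->]]] [d [L [dS ->]]].
have -> : seqmul (\sum_(a < K) c a *: f a) (\sum_(b < L) d b *: f b) =
    \sum_(a < K) \sum_(b < L) (c a * d b) *: seqmul (f a) (f b).
  apply/val_inj/funext => m.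
  change (\val (\sum_(a < K) c a *: f a) m * \val (\sum_(b < L) d b *: f b) m =
    \val (\sum_(a < K) \sum_(b < L) (c a * d b) *: seqmul (f a) (f b)) m).
  rewrite !val_sum mulr_suml; apply: eq_bigr => a _.
  rewrite val_sum mulr_sumr; apply: eq_bigr => b _; rewrite !valZ_coord.
  by rewrite mulrACA.
apply: spanset_sum => a; apply: spanset_sum => b.
have [->|/cS[Sa _]] := eqVneq (c a) 0; first by rewrite mul0r scale0r; exact: spanset0.
have [->|/dS[Sb _]] := eqVneq (d b) 0; first by rewrite mulr0 scale0r; exact: spanset0.
have [Sab ->] := SM _ _ Sa Sb.
by apply: spansetZ; exact: spanset_gen.
Qed.

End Span.

(** * Generators built from the tower and their orbits *)

Section TowerAlgebra.
Context {R : realType} {X : seqAlgebra R} {e : nat -> X}.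
Hypothesis eE : forall n, \val (e n) = unit_seq R n.
Hypothesis basis_e : schauder_basis e.
Context {q0 : nat}.
Hypothesis unit_ge1 : forall q n, (q0 <= q)%N -> 1 <= seqnorm q (e n).
Context {w : nat -> R[i]} {B : {linear X -> X}}.
Hypothesis BE : forall x, \val (B x) = backward_shift w (\val x).
Context {bt M N : nat -> nat} {v chi : nat -> nat -> R[i]}.
Hypothesis tower : character_tower e w q0 bt v M N chi.
Context {pr : nat -> nat}.
Hypothesis pr_prime : forall m, prime (pr m).
Hypothesis prS : forall m, (pr m < pr m.+1)%N.

Let MS := tower_MS tower.

Lemma pr_gt m : (m < pr m)%N.
Proof. by elim: m => [|m IH]; rewrite ?prime_gt0// (leq_ltn_trans IH). Qed.

Lemma pr_inj : injective pr.
Proof. by apply: incn_inj; apply: leq_mono; exact: (homo_ltn ltn_trans). Qed.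

(* Removing the powers of [pr m] makes the [pr m ^ k]-th function equal to [1]
   at [m]: the corresponding vectors converge to [e m] as [k] grows. *)
Definition gcoord (a m : nat) : R[i] := chi m (partn a (negn (pr m))).

Lemma gcoordM a b m : (0 < a)%N -> (0 < b)%N ->
  gcoord (a * b) m = gcoord a m * gcoord b m.
Proof.
by move=> a0 b0; rewrite /gcoord partnM// (tower_chiM tower)// part_gt0.
Qed.

Lemma gcoord_chi a m : (0 < a)%N -> ~~ (pr m %| a)%N -> gcoord a m = chi m a.
Proof. by move=> a0 pa; rewrite /gcoord part_pnat_id// p'natE. Qed.

(** The prime [pr m] exceeds [m], so it cannot divide [a]. Hence removing powers of primes alters
    only finitely many coordinates of each generator. *)
Lemma gcoord_large a m : (0 < a)%N -> (a <= m)%N -> gcoord a m = chi m a.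
Proof.
move=> a0 am; rewrite gcoord_chi// gtnNdvd//.
exact: leq_ltn_trans am (pr_gt m).
Qed.

Lemma gcoord_pow k m : gcoord (pr m ^ k) m = 1.
Proof.
by rewrite /gcoord part_p'nat ?(tower_chi1 tower)// pnatNK pnatX pnat_id.
Qed.

Lemma gcoord_pow_neq k m m' : m' != m ->
  gcoord (pr m ^ k) m' = chi m' (pr m ^ k)%N.
Proof.
move=> mm'; rewrite gcoord_chi ?expn_gt0 ?prime_gt0//.
rewrite Euclid_dvdX// dvdn_prime2//; apply: contra mm' => /andP[/eqP h _].
by apply/eqP/pr_inj.
Qed.

(** The summand 1 accounts for all blocks from index [q] on. *)
Definition tail_weight q : R :=
  \sum_(0 <= m < M q) normc (chi m 2) * seqnorm q (e m) + 1.

Lemma tail_weight_ge0 q : 0 <= tail_weight q.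
Proof.
rewrite addr_ge0// sumr_ge0// => m _.
by rewrite mulr_ge0 ?normc_ge0 ?seqnorm_ge0.
Qed.

(** For [i >= q], the seminorm of index [q0 + i] controlling block [i] dominates that of index [q],
    so the later blocks add up to at most [2^-q <= 1]. *)
Lemma sum_tail_le q K :
  \sum_(0 <= m < K) normc (chi m 2) * seqnorm q (e m) <= tail_weight q.
Proof.
have g0 m : 0 <= normc (chi m 2) * seqnorm q (e m).
  by rewrite mulr_ge0 ?normc_ge0 ?seqnorm_ge0.
apply: le_trans (_ : \sum_(0 <= m < M q + K) normc (chi m 2) * seqnorm q (e m) <= _).
  by rewrite [leRHS](big_cat_nat (leq0n _) (leq_addl _ _))//= lerDl sumr_ge0.
rewrite (big_cat_nat (leq0n _) (leq_addr _ _))//= lerD2l.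
apply: le_trans (_ : 2^-1 ^+ q <= _); last by rewrite exprn_ile1 ?invr_ge0 ?invf_le1 ?ler1n.
apply: (sum_blocks_le MS) => // i qi.
apply: le_trans (tower_small tower (leq0n (M i))).
rewrite big_nat [leRHS]big_nat; apply: ler_sum => m _.
rewrite wprod0 normc1 mul1r subn0 ler_wpM2l ?normc_ge0// seqnorm_homo//.
by rewrite (leq_trans qi)// leq_addl.
Qed.

Lemma le_chi2 m a : (1 < a)%N -> normc (chi m a) <= normc (chi m 2).
Proof.
move=> a1; apply: le_trans (tower_decay tower m a1) _.
by rewrite ler_piMl ?normc_ge0// ler_pdivrMr ?mul1r ?ler_nat// ltr0n ltnW.
Qed.

(** From position [a] on, the coordinates are those of [chi], dominated by the summable ones of
    index 2; [seq_exists] applies. *)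
Lemma exists_generator a : frechet_sequence_algebra X -> (1 < a)%N ->
  exists x : X, \val x = gcoord a.
Proof.
move=> fX a1; apply: (seq_exists eE unit_ge1) => // q.
pose g m := normc (gcoord a m) * seqnorm q (e m).
have g0 m : 0 <= g m by rewrite mulr_ge0 ?normc_ge0 ?seqnorm_ge0.
exists (\sum_(0 <= m < a) g m + tail_weight q) => K.
rewrite -(big_mkord xpredT g).
apply: le_trans (_ : \sum_(0 <= m < a + K) g m <= _).
  by rewrite [leRHS](big_cat_nat (leq0n _) (leq_addl _ _))//= lerDl sumr_ge0.
rewrite (big_cat_nat (leq0n _) (leq_addr _ _))//= lerD2l.
apply: le_trans (sum_tail_le q (a + K)).
rewrite [leRHS](big_cat_nat (leq0n _) (leq_addr K a))//=.
apply: ler_wpDl; first by rewrite sumr_ge0// => m _; rewrite mulr_ge0 ?normc_ge0 ?seqnorm_ge0.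
rewrite big_nat [leRHS]big_nat; apply: ler_sum => m /andP[am _].
by rewrite /g gcoord_large ?(ltnW a1)// ler_wpM2r ?seqnorm_ge0 ?le_chi2.
Qed.

Context {f : nat -> X}.
Hypothesis fE : forall a, (1 < a)%N -> \val (f a) = gcoord a.

Lemma generatorM a b : (1 < a)%N -> (1 < b)%N ->
  seqmul (f a) (f b) = f (a * b)%N.
Proof.
move=> a1 b1; apply/val_inj/funext => m.
change (\val (f a) m * \val (f b) m = \val (f (a * b)%N) m).
rewrite !fE// ?gcoordM ?(ltnW a1) ?(ltnW b1)//.
by rewrite (leq_trans a1)// leq_pmulr// ltnW.
Qed.

(** At [m] the difference vanishes; elsewhere [tower_decay] gives the factor [2 / pr m ^ k], at most
    [2 / k]. *)
Lemma generator_pow_close m k q : (0 < k)%N ->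
  seqnorm q (f (pr m ^ k)%N - e m) <= 2 / k%:R * tail_weight q.
Proof.
move=> k0; have p1 := prime_gt1 (pr_prime m).
have a1 : (1 < pr m ^ k)%N by rewrite -(exp1n k) ltn_exp2r.
have ka : (k <= pr m ^ k)%N by rewrite ltnW// ltn_expl.
apply: (seqnorm_le eE basis_e unit_ge1) => K.
apply: le_trans (_ : \sum_(l < K) 2 / k%:R * (normc (chi l 2) * seqnorm q (e l)) <= _); last first.
  rewrite -mulr_sumr ler_wpM2l ?divr_ge0//.
  by rewrite -(big_mkord xpredT (fun l => normc (chi l 2) * seqnorm q (e l))) sum_tail_le.
apply: ler_sum => l _; rewrite mulrA ler_wpM2r ?seqnorm_ge0// valB_coord fE// eE /unit_seq.
have [->|lm] := eqVneq (l : nat) m.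
  by rewrite gcoord_pow subrr normc0 mulr_ge0 ?normc_ge0 ?divr_ge0.
rewrite gcoord_pow_neq// subr0; apply: le_trans (tower_decay tower _ a1) _.
by rewrite ler_wpM2r ?normc_ge0// ler_wpM2l// lef_pV2 ?posrE ?ltr0n ?(ltnW a1)// ler_nat.
Qed.

(** In block [j] the term of index [bt j] reproduces [y] exactly and cancels. What remains, the
    higher indices in this block and all indices in later blocks, contributes half of the bound
    each. The condition [K <= N j] makes [gcoord] and [chi] agree at every position involved. *)
Lemma orbit_close (c : nat -> R[i]) K j (x y : X) : (1 < bt j)%N ->
  (bt j < K)%N -> (K <= N j)%N ->
  (forall m, \val x m = \sum_(bt j <= a < K) c a * gcoord a m) ->
  (forall l, \val y l = c (bt j) * v j l) ->
  seqnorm (q0 + j) (iter (N j) B x - y)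
    <= (\sum_(bt j <= a < K) normc (c a)) * 2^-1 ^+ j.
Proof.
move=> b1 bK KN xE yE; set C := \sum_(_ <= _ < _) normc _.
set b := bt j in b1 bK xE yE C *; set n := N j in KN *.
have C0 : 0 <= C by rewrite sumr_ge0// => a _; exact: normc_ge0.
(* Terms are indexed by the position [m] before the shift, to match the blocks. *)
pose g m := normc (\val (iter n B x - y) (m - n)%N) * seqnorm (q0 + j) (e (m - n)%N).
have g0 m : 0 <= g m by rewrite mulr_ge0 ?normc_ge0 ?seqnorm_ge0.
have coordE m : (n <= m)%N -> \val (iter n B x - y) (m - n)%N =
    wprod w n (m - n) * \sum_(b <= a < K) c a * chi m a - c b * v j (m - n)%N.
  move=> nm; rewrite valB_coord (val_iter_shift BE) yE xE subnKC//.
  congr (_ * _ - _); rewrite big_nat [RHS]big_nat; apply: eq_bigr => a /andP[ba aK].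
  by rewrite gcoord_large ?(leq_trans (ltnW b1) ba)// ltnW// (leq_trans aK)// (leq_trans KN).
have /andP[Mn nM] : (M j <= n < M j.+1)%N by exact: (tower_N tower).
have bd1 : \sum_(n <= m < M j.+1) g m <= C * 2^-1 ^+ j.+1.
  apply: le_trans (ler_wpM2l C0 (tower_higher tower j)); rewrite mulr_sumr.
  rewrite big_nat [leRHS]big_nat; apply: ler_sum => m /andP[nm mM].
  rewrite /g mulrA ler_wpM2r ?seqnorm_ge0// coordE// big_ltn// mulrDr.
  rewrite mulrCA -[X in chi X b](subnKC nm) (tower_target tower) ?subnKC//.
  rewrite addrAC subrr add0r mulr_sumr.
  apply: le_trans (le_normc_sum _ _ _) _; rewrite /C (big_ltn bK) mulrDl.
  apply: ler_wpDl; first by rewrite !mulr_ge0 ?normc_ge0.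
  rewrite mulr_suml big_nat [leRHS]big_nat; apply: ler_sum => a /andP[ba aK].
  rewrite !normcM mulrCA ler_wpM2l ?normc_ge0// ler_wpM2l ?normc_ge0//.
  by apply: (tower_anti tower); rewrite ?mM ?(leq_trans Mn nm).
(* Here [y] vanishes, and [tower_small] applies with the shift [N j], which does not exceed the
   start of any later block. *)
have bd2 K' : \sum_(M j.+1 <= m < K') g m <= C * 2^-1 ^+ j.+1.
  pose h m := normc (wprod w n (m - n)) * normc (chi m 2)
      * seqnorm (q0 + j) (e (m - n)%N).
  have h0 m : 0 <= h m by rewrite !mulr_ge0 ?normc_ge0 ?seqnorm_ge0.
  apply: le_trans (_ : C * \sum_(M j.+1 <= m < K') h m <= _); last first.
    apply: ler_wpM2l => //; apply: (sum_blocks_le MS) => // i ji.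
    have nMi : (n <= M i)%N by rewrite (leq_trans (ltnW nM))// (start_mono MS).
    apply: le_trans (tower_small tower nMi).
    rewrite big_nat [leRHS]big_nat; apply: ler_sum => m _.
    by rewrite ler_wpM2l ?mulr_ge0 ?normc_ge0// seqnorm_homo// leq_add2l ltnW.
  rewrite mulr_sumr big_nat [leRHS]big_nat; apply: ler_sum => m /andP[Mm _].
  have nm : (n <= m)%N by rewrite (leq_trans (ltnW nM)).
  rewrite /g /h mulrA ler_wpM2r ?seqnorm_ge0// coordE//.
  rewrite (tower_target0 tower) ?subnKC// mulr0 subr0 mulr_sumr.
  apply: le_trans (le_normc_sum _ _ _) _.
  rewrite /C mulr_suml big_nat [leRHS]big_nat; apply: ler_sum => a /andP[ba aK].
  rewrite !normcM mulrCA ler_wpM2l ?normc_ge0// ler_wpM2l ?normc_ge0//.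
  by rewrite le_chi2// (leq_trans b1).
apply: (seqnorm_le eE basis_e unit_ge1) => K'.
have -> : \sum_(l < K') normc (\val (iter n B x - y) l) * seqnorm (q0 + j) (e l)
    = \sum_(n <= m < n + K') g m.
  have -> : \sum_(n <= m < n + K') g m = \sum_(0 <= l < K') g (l + n)%N.
    by rewrite -{1}[n]add0n big_addn addKn.
  by rewrite big_mkord; apply: eq_bigr => l _; rewrite /g addnK.
apply: le_trans (_ : \sum_(n <= m < M j.+1 + (n + K')) g m <= _).
  rewrite [leRHS](big_cat_nat (leq_addr K' n) (leq_addl _ _))//= lerDl.
  by rewrite sumr_ge0.
rewrite (big_cat_nat (ltnW nM) (leq_addr _ _))//=.
apply: le_trans (lerD bd1 (bd2 _)) _; rewrite -mulrDr ler_wpM2l// exprS; lra.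
Qed.

End TowerAlgebra.

Lemma half_pow_small (R : realType) (C eps : R) : 0 <= C -> 0 < eps ->
  exists J, forall j, (J <= j)%N -> C * 2^-1 ^+ j < eps.
Proof.
move=> C0 eps0; have Ce : 0 <= C / eps by rewrite divr_ge0// ltW.
exists (Num.bound (C / eps)) => j Jj.
rewrite exprVn ltr_pdivrMr ?exprn_gt0// mulrC -ltr_pdivrMr//.
apply: lt_le_trans (archi_boundP Ce) _; rewrite -natrX ler_nat.
by rewrite (leq_trans Jj)// ltnW// ltn_expl.
Qed.

(** * Hypercyclicity, density and infinite generation of the span *)

Section Sufficiency.
Context {R : realType} {X : seqAlgebra R} {e : nat -> X}.
Hypothesis frechetX : frechet_sequence_algebra X.
Hypothesis eE : forall n, \val (e n) = unit_seq R n.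
Hypothesis basis_e : schauder_basis e.
Context {q0 : nat}.
Hypothesis unit_ge1 : forall q n, (q0 <= q)%N -> 1 <= seqnorm q (e n).
Context {w : nat -> R[i]} {B : {linear X -> X}}.
Hypothesis BE : forall x, \val (B x) = backward_shift w (\val x).

Lemma zero_not_hypercyclic : ~ hypercyclic_vectors B (0 : X).
Proof.
pose O : set X := [set y | seqnorm q0 (y - e 0%N) < 1].
move=> h; have [|y [Oy [n _ yE]]] := h O _ (@open_seqball R X q0 (e 0%N) 1).
  by exists (e 0%N); rewrite /O /= subrr seqnorm0.
move: Oy; rewrite /O /= -yE iter_shift0 sub0r seqnormN ltNge.
by rewrite unit_ge1.
Qed.

(** Reading the code from the exponent of 2 makes every pair of base and target recur, by
    [recurring_code]. *)
Definition stage_code (j : nat) : nat * seq (rat * rat) :=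
  odflt (0%N, [::]) (unpickle (logn 2 j)).

(** The shift by 2 makes every base at least 2. *)
Definition stage_base j := (stage_code j).1.+2.

Definition stage_target j : nat -> R[i] := ratseq (stage_code j).2.

Context {M N : nat -> nat} {chi : nat -> nat -> R[i]}.
Hypothesis tower : character_tower e w q0 stage_base stage_target M N chi.
Context {pr : nat -> nat}.
Hypothesis pr_prime : forall m, prime (pr m).
Hypothesis prS : forall m, (pr m < pr m.+1)%N.
Context {f : nat -> X}.
Hypothesis fE : forall a, (1 < a)%N -> \val (f a) = gcoord (chi := chi) (pr := pr) a.

Let gt1 : set nat := [set a | (1 < a)%N].

(* The smallest index [b] in the combination plays the role of the dominant
   monomial: the stages of base [b] bring the orbit near any target. *)
Lemma comb_hypercyclic (c : nat -> R[i]) K a0 : comb_supp c gt1 K ->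
  c a0 != 0 -> hypercyclic_vectors B (\sum_(a < K) c a *: f a).
Proof.
move=> cS ca0; have ex : exists a, c a != 0 by exists a0.
case: (ex_minnP ex) => b cb bmin; have [b1 bK] := cS b cb.
set x : X := \sum_(_ < _) _.
have xE m : \val x m = \sum_(b <= a < K) c a * gcoord (chi := chi) (pr := pr) a m.
  have -> : x = \sum_(b <= a < K) c a *: f a.
    rewrite /x -(big_mkord xpredT (fun a => c a *: f a)).
    rewrite (big_cat_nat (leq0n b) (ltnW bK))//= [X in X + _]big_nat.
    rewrite [X in X + _]big1 ?add0r// => a /andP[_ ab].
    have [->|/bmin] := eqVneq (c a) 0; first by rewrite scale0r.
    by rewrite leqNgt ab.
  rewrite val_sum big_nat [RHS]big_nat; apply: eq_bigr => a /andP[ba _].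
  by rewrite valZ_coord fE// (leq_trans b1).
move=> O [y0 Oy0] oO; have : nbhs y0 O by exact: open_nbhs_nbhs.
move=> /nbhs_seqnorm[q [eps [eps0 hO]]].
have e2 : 0 < eps / 2 by rewrite divr_gt0.
have cb0 : 0 < normc (c b) by rewrite normc_gt0.
(* The orbit will approach [c b] times the stage target, so [y0] is first divided by [c b]. *)
have [s hs] := ratseq_dense eE basis_e unit_ge1 ((c b)^-1 *: y0) q
  (divr_gt0 e2 cb0).
pose y : X := c b *: \sum_(i < size s) ratseq s i *: e i.
have yE l : \val y l = c b * ratseq s l.
  rewrite valZ_coord (val_unit_sum eE); case: ltnP => // sl.
  by rewrite ratseq_default.
have yy0 : seqnorm q (y - y0) < eps / 2.
  have -> : y - y0 =
      c b *: (\sum_(i < size s) ratseq s i *: e i - (c b)^-1 *: y0).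
    by rewrite scalerBr scalerA divff// scale1r.
  by rewrite seqnormZ mulrC -ltr_pdivlMr.
pose C := \sum_(b <= a < K) normc (c a).
have C0 : 0 <= C by rewrite sumr_ge0// => a _; exact: normc_ge0.
have [J hJ] := half_pow_small C0 e2.
(* The stage is late enough for its seminorm to dominate [q], for [K <= N j], and for an error below
   [eps / 2]. *)
have [j Jj jE] := recurring_code (0%N, [::]) (b.-2, s) (maxn q (maxn K J)).
move: Jj; rewrite !geq_max => /and3P[qj Kj Jj].
have bj : stage_base j = b.
  by rewrite /stage_base /stage_code jE /=; case: (b) b1 => [|[]].
have vj : stage_target j = ratseq s by rewrite /stage_target /stage_code jE.
have KN : (K <= N j)%N.
  have /andP[MN _] := tower_N tower j.
  by rewrite (leq_trans Kj)// (leq_trans (start_ge (tower_MS tower) j)).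
have := @orbit_close _ _ _ eE basis_e _ unit_ge1 _ _ BE _ _ _ _ _ tower _
  pr_prime prS c K j x y.
rewrite bj vj => /(_ b1 bK KN xE yE) close.
exists (iter (N j) B x); split; last by exists (N j).
apply: hO; rewrite seqnormB.
have -> : iter (N j) B x - y0 = (iter (N j) B x - y) + (y - y0).
  by rewrite addrA subrK.
rewrite (splitr eps); apply: le_lt_trans (seqnormD _ _ _) _; apply: ltrD => //.
apply: le_lt_trans (hJ j Jj); apply: le_trans close.
by rewrite seqnorm_homo// (leq_trans qj)// leq_addl.
Qed.

Let algebra_gt1 : subalgebra (spanset f gt1).
Proof.
apply: spanset_subalgebra => a b a1 b1; split.
  by rewrite /gt1 /= (leq_trans (a1 : (1 < a)%N))// leq_pmulr// ltnW.
exact: (generatorM tower fE).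
Qed.

Lemma span_hypercyclic_algebra : hypercyclic_algebra B (spanset f gt1).
Proof.
have hc : spanset f gt1 `<=` hypercyclic_vectors B `|` [set 0].
  move=> x [c [K [cS ->]]].
  have [[a ca]|h] := pselect (exists a, c a != 0).
    by left; exact: comb_hypercyclic ca.
  right; rewrite /= big1// => a _; have [->|ca] := eqVneq (c a) 0.
    by rewrite scale0r.
  by case: h; exists a.
split=> // h; apply: zero_not_hypercyclic.
(* If the span were trivial, [f 2] would be 0, yet it is hypercyclic as a nontrivial combination. *)
have <- : f 2 = 0 by have := spanset_gen f (isT : gt1 2); rewrite h.
have := @comb_hypercyclic (fun b => (b == 2)%:R) 3 2.
rewrite !big_ord_recr big_ord0 /= !scale0r !add0r scale1r; apply; last first.
  exact: oner_neq0.
by move=> a; rewrite pnatr_eq0 eqb0 negbK => /eqP ->.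
Qed.

(** Truncate the expansion of the target and replace each [e i] by [f (pr i ^ k)] with [k] large;
    [D / k] bounds the resulting error. *)
Lemma span_dense : dense (spanset f gt1).
Proof.
move=> O [y0 Oy0] oO; have : nbhs y0 O by exact: open_nbhs_nbhs.
move=> /nbhs_seqnorm[q [eps [eps0 hO]]].
have e2 : 0 < eps / 2 by rewrite divr_gt0.
have [K hK] := filter_ex (unit_expansion eE basis_e unit_ge1 y0 q e2).
pose D := (\sum_(i < K) normc (\val y0 i)) * 2 * tail_weight (e := e) (M := M) (chi := chi) q.
have D0 : 0 <= D.
  by rewrite !mulr_ge0 ?tail_weight_ge0// sumr_ge0// => i _; exact: normc_ge0.
have [k k0 kD] : exists2 k, (0 < k)%N & D / k%:R < eps / 2.
  have De : 0 <= D / (eps / 2) by rewrite divr_ge0// ltW.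
  exists (Num.bound (D / (eps / 2))).+1 => //.
  rewrite ltr_pdivrMr// mulrC -ltr_pdivrMr//.
  by apply: lt_le_trans (archi_boundP De) _; rewrite ler_nat.
pose z : X := \sum_(i < K) \val y0 i *: f (pr i ^ k)%N.
exists z; split; last first.
  apply: spanset_sum => i; apply: spansetZ; apply: spanset_gen.
  by rewrite /gt1 /= -(exp1n k) ltn_exp2r// prime_gt1.
apply: hO; rewrite seqnormB.
pose s := \sum_(i < K) \val y0 i *: e i.
have -> : z - y0 = (z - s) + (s - y0) by rewrite addrA subrK.
rewrite (splitr eps); apply: le_lt_trans (seqnormD _ _ _) _; apply: ltrD => //.
apply: le_lt_trans kD; rewrite /z /s -sumrB.
apply: le_trans (seqnorm_sum _ _ _ _) _; rewrite /D -!mulrA mulr_suml.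
apply: ler_sum => i _; rewrite -scalerBr seqnormZ ler_wpM2l ?normc_ge0//.
apply: le_trans (generator_pow_close eE basis_e unit_ge1 tower pr_prime prS fE i q k0) _.
by rewrite mulrA [2 * _ * _]mulrAC.
Qed.

(** Finitely many generators lie in the span over integers whose prime factors are below some [K],
    which is a subalgebra. It would contain [f p] for a prime [p > K], a nontrivial relation; but
    nontrivial combinations are hypercyclic, hence nonzero. *)
Lemma span_not_finitely_generated : ~ finitely_generated (spanset f gt1).
Proof.
move=> [G /finite_seqP[s ->] AE].
pose smooth K : set nat :=
  [set a | (1 < a)%N /\ forall p, prime p -> (p %| a)%N -> (p < K)%N].
have smoothS K K' : (K <= K')%N -> smooth K `<=` smooth K'.
  move=> KK a [a1 h]; split => // p pp pa; exact: leq_trans (h p pp pa) KK.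
have sA : [set` s] `<=` spanset f gt1.
  by rewrite AE; exact: sub_smallest.
have [K hK] : exists K, [set` s] `<=` spanset f (smooth K).
  elim: s sA {AE} => [|g s IH] sA; first by exists 0%N.
  have [|K hK] := IH; first by move=> x xs; apply: sA; rewrite /= inE (xs : x \in s) orbT.
  have [c [L [cS gE]]] : spanset f gt1 g by apply: sA; rewrite /= inE eqxx.
  exists (maxn K L) => x; rewrite /= inE => /orP[/eqP ->|/hK]; last first.
    by apply: spansetS; apply: smoothS; exact: leq_maxl.
  exists c, L; split => // a /cS[a1 aL]; split => //; split => // p pp pa.
  by rewrite leq_max (leq_ltn_trans (dvdn_leq _ pa) aL) ?orbT// ltnW.
have smooth_alg : subalgebra (spanset f (smooth K)).
  apply: spanset_subalgebra => a b [a1 ha] [b1 hb]; split; last first.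
    exact: (generatorM tower fE).
  split; first by rewrite (leq_trans a1)// leq_pmulr// ltnW.
  by move=> p pp; rewrite Euclid_dvdM// => /orP[]; [exact: ha|exact: hb].
have [p Kp pp] := prime_above K.
have : spanset f (smooth K) (f p).
  apply: (smallest_sub smooth_alg hK); rewrite -AE.
  by apply: spanset_gen; exact: prime_gt1.
move=> [c [L [cS fpE]]]; apply: zero_not_hypercyclic.
have cp : c p = 0.
  apply/eqP; apply: contraT => /cS[[_ h] _].
  by have := h p pp (dvdnn p); rewrite ltnNge ltnW.
(* The relation is nontrivial: its coefficient at [p] is [-1], since [c] is supported on smooth
   indices. *)
pose d a := c a - (a == p)%:R.
have dS : comb_supp d gt1 (maxn L p.+1).
  move=> a; rewrite /d; have [->|ap] := eqVneq a p.
    by move=> _; split; [exact: prime_gt1|rewrite leq_max leqnn orbT].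
  by rewrite subr0 => /cS[[a1 _] aL]; split; rewrite // leq_max aL.
have <- : \sum_(a < maxn L p.+1) d a *: f a = 0.
  under eq_bigr do rewrite scalerBl.
  rewrite sumrB -(comb_widen f (leq_maxl L p.+1) cS) -fpE.
  rewrite (bigD1 (Ordinal (leq_maxr L p.+1)))//= eqxx scale1r big1 ?addr0 ?subrr//.
  move=> a ap; rewrite [(a : nat) == p](_ : _ = false) ?scale0r//.
  by apply: contraNF ap => /eqP ap; apply/eqP/val_inj.
apply: (comb_hypercyclic (a0 := p) dS).
by rewrite /d cp eqxx sub0r oppr_eq0 oner_neq0.
Qed.
End Sufficiency.

Theorem theorem1p2 (R : realType) (X : seqAlgebra R)
  (frechetX : frechet_sequence_algebra X)
  (normX : admits_continuous_norm X)
  (e : nat -> X) (eE : forall n, \val (e n) = unit_seq R n)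
  (basis_e : schauder_basis e)
  (w : nat -> R[i]) (w_neq0 : forall n, (0 < n)%N -> w n != 0)
  (B : {linear X -> X}) (BE : forall x, \val (B x) = backward_shift w (\val x))
  (bounded_B : continuous B) :
  (exists A : set X,
     [/\ hypercyclic_algebra B A, dense A & ~ finitely_generated A])
  <->
  (exists2 n : nat -> nat, (forall k, (0 < n k)%N) &
     forall (gamma : R) (l : nat), 0 < gamma -> (0 < l)%N ->
     forall c : nat -> R[i],
       (forall k, cpow_determination
          (\prod_(l.+1 <= j < (n k + l).+1) w j) (- gamma) (c k)) ->
       c k *: e (n k + l)%N @[k --> \oo] --> (0 : X)).
Proof.
have [q0 unit_ge1] := seqnorm_unit_ge1 eE normX.
split=> [[A [hA _ _]]|[n _ n_decay]].
  have [n n0 hn] := necessity eE basis_e unit_ge1 w_neq0 BE hA.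
  by exists n => // gamma l g0 _; exact: hn.
have [M [N [chi tower]]] := exists_tower eE unit_ge1 w_neq0 BE bounded_B n_decay
  (bt := stage_base) (v := @stage_target R) (L := fun j => size (stage_code j).2)
  (fun=> isT) (fun j l => @ratseq_default R (stage_code j).2 l).
have [pr [pr_prime prS]] := increasing_primes.
have [f fE] : {f : nat -> X & forall a, (1 < a)%N ->
    \val (f a) = gcoord (chi := chi) (pr := pr) a}.
  apply: (@choice _ _ (fun a (x : X) => (1 < a)%N ->
    \val x = gcoord (chi := chi) (pr := pr) a)) => a.
  have [a1|_] := ltnP 1 a; last by exists 0.
  by have [x xE] := exists_generator eE unit_ge1 tower pr_prime prS frechetX a1; exists x.
exists (spanset f [set a | (1 < a)%N]); split.
- exact (span_hypercyclic_algebra eE basis_e unit_ge1 BE tower pr_prime prS fE).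
- exact (span_dense eE basis_e unit_ge1 tower pr_prime prS fE).
- exact (span_not_finitely_generated eE basis_e unit_ge1 BE tower pr_prime prS fE).
Qed.
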